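(* Consider the problem of determining, given a Fractran program $F$, whether the corresponding Fractran-type canonical collection $\mathcal{A}_F$ is complete. This problem is undecidable.
   Context: **Undecidable.** A problem that has finite data as input is undecidable if there does not exist an algorithm that solves it for every valid input. Here the input is a Fractran program, i.e. a finite sequence of positive rationals. **Notation.** $\mathbb{N}_0=\{0,1,2,\dots\}$; for $n\in\mathbb{N}$, $[n]=\{0,1,\dots,n-1\}$. **Fractran.** A Fractran program is a finite (nonempty) sequence $F=(F_1,\dots,F_m)$ of positive rational numbers. Inputs are elements of $\mathbb{N}_0$; on the input $0$ the program halts immediately. A single Fractran iteration on $n\geqslant1$ replaces $n$ by $F_k n$, where $k$ is the least index such that $F_kn$ is an integer; if no such $k$ exists, the program halts at $n$. Let $f_F\colon\mathbb{N}_0\to\mathbb{N}_0$ be the function that applies a single Fractran iteration to its input if this is possible, and returns $0$ otherwise (i.e. if the program immediately halts on that input; in particular $f_F(0)=0$). **Canonical collection.** Let $(b_i)_{i\in\mathbb{N}_0}$ be a sequence of integers with $b_i>1$ (the bases), and let $(T_i)_{i\in\mathbb{N}_0}$ be a sequence of subsets of $\mathbb{Z}$ such that each $T_i$ is a complete residue system modulo $b_i$ (it contains exactly one representative of each residue class) and $0\in T_i$. The canonical collection defined by $(b_i)$ and $(T_i)$ is $\{A_i\}_{i\in\mathbb{N}_0}$ with $A_i=b_0b_1\cdots b_{i-1}T_i$, where $kT=\{kt\mid t\in T\}$ and the empty product is $1$. It is called complete if it is an additive system for $\mathbb{Z}$, i.e. every $n\in\mathbb{Z}$ has exactly one representation $n=a_0+a_1+\cdots$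 with $a_i\in A_i$ for all $i$ and all but finitely many $a_i$ equal to $0$. **Associated canonical system.** For $n\in\mathbb{Z}$ let $t_i(n)$ be the unique element of $T_i$ congruent to $n$ modulo $b_i$, and let $f_i(n)=\frac{1}{b_i}(n-t_i(n))$. Given the bases, the sets $T_i$ are determined by the values $f_i(r)$ for $r\in[b_i]$ via $T_i=\{r-b_if_i(r)\mid r\in[b_i]\}$; these values may be prescribed as arbitrary integers subject only to $f_i(0)=0$. **Fractran-type canonical collection $\mathcal{A}_F$.** Put $b=1+\left\lceil\max_{1\leqslant k\leqslant m}F_k\right\rceil$ and $b_i=b^{i+1}$ for $i\in\mathbb{N}_0$. The sets $T_i$ are determined via $T_i=\{r-b_if_i(r)\mid r\in[b_i]\}$ by setting $f_i(r)=f_F(r)$ for $r\in[b_i-1]=\{0,1,\dots,b_i-2\}$ and $f_i(b_i-1)=1$. $\mathcal{A}_F$ is the canonical collection defined by these $(b_i)$ and $(T_i)$. *)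

(* Defs.v *)
From HB Require Import structures.
From mathcomp Require Import all_boot all_order all_algebra.
From mathcomp Require Import classical_sets.

Set Implicit Arguments.
Unset Strict Implicit.
Unset Printing Implicit Defensive.

Import Order.TTheory GRing.Theory Num.Theory.

Local Open Scope ring_scope.

(* Algorithms are mu-recursive functions. *)
Inductive murec : nat -> Type :=
| Zero : murec 0
| Succ : murec 1
| Proj n : 'I_n -> murec n
| Comp m n : murec m -> ('I_m -> murec n) -> murec n
| Prec n : murec n -> murec n.+2 -> murec n.+1
| Mu n : murec n.+1 -> murec n.

(* [murec_eval f v y] says that [f], applied to [v], halts with value [y]:
   - in [Prec g h] the recursion argument is the first one, with
     f(0, w) = g(w) and f(i + 1, w) = h(i, f(i, w), w), and [s] lists the
     successive values f(0, w), f(1, w), ...;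
   - [Mu g] returns the least [y] with g(y, v) = 0, and requires g(z, v) to be
     defined for all z < y. *)
Fixpoint murec_eval n (f : murec n) : n.-tuple nat -> nat -> Prop :=
  match f in murec n return n.-tuple nat -> nat -> Prop with
  | Zero => fun _ y => y = 0%N
  | Succ => fun v y => y = (thead v).+1
  | Proj _ i => fun v y => y = tnth v i
  | Comp m _ g h => fun v y =>
      exists2 w : m.-tuple nat,
        forall i, murec_eval (h i) v (tnth w i) & murec_eval g w y
  | Prec n g h => fun v y =>
      let w : n.-tuple nat := behead_tuple v in
      exists s : nat -> nat,
        [/\ murec_eval g w (s 0%N),
            forall i, (i < thead v)%N ->
              murec_eval h [tuple of i :: s i :: w] (s i.+1)
          & y = s (thead v)]
  | Mu _ g => fun v y =>
      murec_eval g [tuple of y :: v] 0%N /\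
      forall z, (z < y)%N -> exists c, murec_eval g [tuple of z :: v] c.+1
  end.

(* Nothing is required of [d] on numbers that encode no instance. *)
Definition decides (T : Type) (enc : T -> nat) (P : T -> Prop) (d : murec 1) :=
  forall x : T,
    (P x -> murec_eval d [tuple enc x] 1%N) /\
    (~ P x -> murec_eval d [tuple enc x] 0%N).

Definition undecidable (T : Type) (enc : T -> nat) (P : T -> Prop) :=
  ~ exists d : murec 1, decides enc P d.

Record fractran := Fractran {
  fractions :> seq rat;
  fractions_neq0 : fractions != [::];
  fractions_gt0 : all (fun q => 0 < q) fractions
}.

(* The program is written down as p_1, q_1, ..., p_m, q_m, where p_k / q_k is
   F_k in lowest terms; this list is turned into a number by the bijection
   [CodeSeq.code], [:: n_1; ...; n_l] |-> 2^n_1 (2 (2^n_2 (...)) + 1). *)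
Definition encode_fractran (F : fractran) : nat :=
  CodeSeq.code (flatten [seq [:: `|numq q|%N; `|denq q|%N] | q <- F]).

(* The value is 0 if the program halts immediately on [n]; on n = 0 both
   branches give 0. *)
Fixpoint fractran_step (F : seq rat) (n : nat) : nat :=
  if F is q :: F' then
    if q * n%:R \is a Num.int then Num.truncn (q * n%:R)
    else fractran_step F' n
  else 0%N.

Definition complete_residue_system (b : int) (T : set int) :=
  forall n : int, exists! t : int, T t /\ (t = n %[mod b])%Z.

Definition canonical_collection (b : nat -> int) (T : nat -> set int)
    (i : nat) : set int :=
  [set (\prod_(j < i) b j) * t | t in T i]%classic.

Definition is_representation (A : nat -> set int) (n : int) (a : nat -> int) :=
  (forall i, A i (a i)) /\
  exists N : nat, (forall i, (N <= i)%N -> a i = 0) /\ n = \sum_(i < N) a i.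

Definition additive_system (A : nat -> set int) :=
  forall n : int, exists! a : nat -> int, is_representation A n a.

(* The maximum may start from 0 since the fractions are positive. *)
Definition fractran_base (F : fractran) : int :=
  1 + Num.ceil (\big[Num.max/0]_(q <- F) q).

Definition fractran_bases (F : fractran) (i : nat) : int :=
  fractran_base F ^+ i.+1.

Definition fractran_values (F : fractran) (i r : nat) : int :=
  if r%:Z == fractran_bases F i - 1 then 1 else (fractran_step F r)%:Z.

Definition fractran_residues (F : fractran) (i : nat) : set int :=
  [set r%:Z - fractran_bases F i * fractran_values F i r
     | r in [set r : nat | r%:Z < fractran_bases F i]]%classic.

Definition fractran_collection (F : fractran) : nat -> set int :=
  canonical_collection (fractran_bases F) (fractran_residues F).

Lemma encode_fractran_inj (F G : fractran) :
  encode_fractran F = encode_fractran G -> F = G :> seq rat.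
Proof.
move=> e; have {e} := can_inj CodeSeq.codeK e.
move: (fractions_gt0 F) (fractions_gt0 G).
elim: (fractions F) (fractions G) => [|p s IHs] [|q t] //=.
case/andP=> p0 s0 /andP[q0 t0] [en ed est]; rewrite (IHs _ s0 t0 est).
congr (_ :: _); rewrite -[p]divq_num_den -[q]divq_num_den.
have -> : numq p = numq q.
  by rewrite -[LHS]gez0_abs ?numq_ge0 ?ltW // en gez0_abs ?numq_ge0 ?ltW.
suff -> : denq p = denq q by [].
by rewrite -[LHS]gez0_abs // ed gez0_abs.
Qed.

Lemma fractran_base_gt1 (F : fractran) : 1 < fractran_base F.
Proof.
rewrite /fractran_base ltrDl -[X in X < _]addr0.
case: F => -[//|q s] _ /= /andP[q0 _].
rewrite big_cons addr0 ceil_gt0 //.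
by rewrite lt_max q0.
Qed.

Lemma fractran_bases_gt1 (F : fractran) i : 1 < fractran_bases F i.
Proof. by rewrite exprn_egt1 // fractran_base_gt1. Qed.

Lemma fractran_residuesP (F : fractran) i :
  complete_residue_system (fractran_bases F i) (fractran_residues F i)
  /\ fractran_residues F i 0.
Proof.
have b1 := fractran_bases_gt1 F i.
set b := fractran_bases F i in b1 *.
have b0 : 0 < b by apply: lt_trans b1.
split; last first.
  exists 0%N => //=; rewrite /fractran_values -/b.
  have /negPf-> : 0%:Z != b - 1 by rewrite lt_eqF // subr_gt0.
  suff -> : fractran_step F 0 = 0%N by rewrite mulr0 subr0.
  case: (F) => s _ _ /=; case: s => //= q s.
  by rewrite mulr0 rpred0 truncn0.
have modE (r : nat) c : ((r%:Z - b * c) = r %[mod b])%Z.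
  by rewrite mulrC -mulNr addrC modzMDl.
move=> n; have n0 : 0 <= (n %% b)%Z by rewrite modz_ge0 // gt_eqF.
have nb : (n %% b)%Z < b by rewrite ltz_pmod.
exists (`|(n %% b)%Z|%N%:Z - b * fractran_values F i `|(n %% b)%Z|%N).
split.
  split; first by exists `|(n %% b)%Z|%N => //=; rewrite gez0_abs.
  by rewrite modE gez0_abs // modz_mod.
move=> _ [[r /= rb <-]]; rewrite modE => e.
by rewrite -e modz_small ?rb ?andbT.
Qed.

Lemma murec_eval_fun n (f : murec n) v y z :
  murec_eval f v y -> murec_eval f v z -> y = z.
Proof.
elim: f v y z => {n} /= [v y z -> -> //|v y z -> -> //|n i v y z -> -> //
  |m n g IHg h IHh v y z [w hw gw] [w' hw' gw']
  |n g IHg h IHh v y z [s [g0 hs ->]] [s' [g0' hs' ->]]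
  |n g IHg v y z [gy ly] [gz lz]].
- suff ew : w = w' by apply: (IHg w) => //; rewrite ew.
  by apply: eq_from_tnth => i; apply: IHh (hw i) (hw' i).
- suff H k : (k <= thead v)%N -> s k = s' k by apply: H.
  elim: k => [_|k IHk ltk]; first exact: IHg g0 g0'.
  have := hs' _ ltk; rewrite -IHk ?(ltnW ltk) // => h'.
  exact: IHh (hs _ ltk) h'.
- case: (ltngtP y z) => // lt.
    by have [c gc] := lz _ lt; have := IHg _ _ _ gy gc.
  by have [c gc] := ly _ lt; have := IHg _ _ _ gz gc.
Qed.

(* Main.v *)
Require Import Defs.
From mathcomp Require Import all_boot all_order all_algebra.
From mathcomp Require Import boolp classical_sets.
From mathcomp Require Import zify.

(* The quotients n, f_0(n), f_1(f_0(n)), ... eventually enter the window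
   [-1, b_i - 2], and from a natural number in it they follow the Fractran
   program, while -1 is sent to 0. As every number occurs as an i-th quotient,
   the collection is complete if and only if the program halts on every input.

   To make universal halting undecidable, a machine is simulated by a Fractran
   program whose every machine step consumes fuel; when the fuel runs out, from
   whatever state, the program cleans up and restarts the machine on a fixed
   input with more fuel than before. If the machine halts on this input, then
   the program halts from all states; otherwise there is a state from which it
   never halts. Given a supposed decision procedure d, the machine applies d to
   the code of its own Fractran program, and halts if and only if d answers 0. *)

Set Implicit Arguments.
Unset Strict Implicit.
Unset Printing Implicit Defensive.

Import Order.TTheory GRing.Theory Num.Theory.

(** * Complete canonical collections *)

Section CanonicalCollections.
Local Open Scope ring_scope.
Variables (b : nat -> int) (T : nat -> set int).
Hypothesis b_gt1 : forall i, 1 < b i.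
Hypothesis T_crs : forall i, complete_residue_system (b i) (T i).

Let B i := \prod_(j < i) b j.

Let b_neq0 i : b i != 0.
Proof. by rewrite gt_eqF // (lt_trans _ (b_gt1 i)). Qed.

Let B_neq0 i : B i != 0.
Proof. by apply/prodf_neq0 => j _; exact: b_neq0. Qed.

Let BS i : B i.+1 = B i * b i.
Proof. by rewrite /B big_ord_recr. Qed.

(** The remainders [z] and [z'] carry the induction: the top digit is absorbed into them, the lower
    digits agree by induction, and after cancelling these the top residues are congruent modulo
    their base, hence equal. *)
Lemma digits_unique N a a' z z' :
  (forall i, canonical_collection b T i (a i)) ->
  (forall i, canonical_collection b T i (a' i)) ->
  \sum_(i < N) a i + B N * z = \sum_(i < N) a' i + B N * z' ->
  forall i, (i < N)%N -> a i = a' i.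
Proof.
move=> Aa Aa'; elim: N z z' => // N IHN z z'; rewrite !big_ord_recr /= BS.
have [t Tt at_] := Aa N; have [t' Tt' at'] := Aa' N.
rewrite -at_ -at' -/(B N) -!addrA -!mulrA -!mulrDr => e.
have eqa := IHN _ _ e; move: e.
rewrite (eq_bigr (fun i : 'I_N => a' i)) => [|i _]; last exact: eqa.
move=> /addrI/(mulfI (B_neq0 N)) e i.
rewrite ltnS leq_eqVlt => /predU1P[->|]; last exact: eqa.
rewrite -at_ -at'; congr (_ * _).
have [s [_ s_uniq]] := T_crs N t; rewrite -(s_uniq t) // (s_uniq t') //; split=> //.
have -> : t' = (z - z') * b N + t by rewrite mulrBl; lia.
by rewrite modzMDl.
Qed.

Lemma representation_unique n a a' :
  is_representation (canonical_collection b T) n a ->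
  is_representation (canonical_collection b T) n a' -> a = a'.
Proof.
move=> [Aa [N [aN na]]] [Aa' [N' [aN' na']]]; apply: funext => i.
have pad c K L : (forall j, (K <= j)%N -> c j = 0) -> n = \sum_(j < K) c j ->
    \sum_(j < K + L) c j = n.
  move=> c0 ->; rewrite big_split_ord /= [X in _ + X]big1 ?addr0 //.
  by move=> j _; rewrite c0 // leq_addr.
(* This length exceeds [i] and covers both supports, so after zero padding both sums equal [n]. *)
apply: (@digits_unique (N + (N' + i.+1)) a a' 0 0) => //; last first.
  by rewrite !addnS ltnS; lia.
by rewrite pad // addnCA pad.
Qed.

Variable q : nat -> int -> int.
Hypothesis q_digit : forall i n, T i (n - b i * q i n).
Hypothesis q0 : forall i, q i 0 = 0.

Fixpoint orbit (n : int) (i : nat) : int :=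
  if i is j.+1 then q j (orbit n j) else n.

Lemma orbit_vanishes n k l : orbit n k = 0 -> (k <= l)%N -> orbit n l = 0.
Proof.
move=> nk /subnK <-; elim: (l - k)%N => //= m IHm.
by rewrite IHm q0.
Qed.

Lemma orbit_expansion n N :
  n = \sum_(i < N) B i * (orbit n i - b i * orbit n i.+1) + B N * orbit n N.
Proof.
elim: N => [|N IHN]; first by rewrite big_ord0 add0r /B big_ord0 mul1r.
rewrite {1}IHN big_ord_recr /= BS mulrBr mulrA addrA -!addrA; congr (_ + _).
by rewrite addNr addr0.
Qed.

(** A representation with [N] digits agrees with the digits read off the orbit, and comparison with
    [orbit_expansion] leaves [B N * orbit n N = 0]. Conversely, an orbit that vanishes at [k] ends
    the expansion there. *)
Lemma additive_system_orbits :
  additive_system (canonical_collection b T) <->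
  forall n, exists k, orbit n k = 0.
Proof.
pose digits n i := B i * (orbit n i - b i * orbit n i.+1).
have digitsP n i : canonical_collection b T i (digits n i).
  by exists (orbit n i - b i * orbit n i.+1) => //; exact: q_digit.
split=> [sysA n|vanish n].
  have [a [[Aa [N [aN na]]] _]] := sysA n; exists N.
  have e := orbit_expansion n N.
  have ad : \sum_(i < N) a i = \sum_(i < N) digits n i.
    apply: eq_bigr => i _; apply: (@digits_unique N _ _ 0 (orbit n N)) => //.
    by rewrite -e mulr0 addr0.
  move: e; rewrite -/(\sum_(i < N) digits n i) -ad -na -{1}[n]addr0.
  by move=> /addrI/esym/eqP; rewrite mulf_eq0 (negPf (B_neq0 N)) => /eqP.
have [k nk] := vanish n.
have rep : is_representation (canonical_collection b T) n (digits n).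
  split=> //; exists k.
  split=> [i ki|]; last by rewrite {1}(orbit_expansion n k) nk mulr0 addr0.
  have [ni ni1] := (orbit_vanishes nk ki, orbit_vanishes nk (leqW ki)).
  by rewrite /digits ni ni1 mulr0 subr0 mulr0.
by exists (digits n); split=> // a; exact: representation_unique.
Qed.

End CanonicalCollections.

(** * Orbits of Fractran-type collections *)

Section FractranCollections.
Local Open Scope ring_scope.
Variable F : fractran.
Let b := fractran_base F.

Lemma fractran_step0 (s : seq rat) : fractran_step s 0 = 0%N.
Proof. by case: s => //= x s; rewrite mulr0 rpred0 truncn0. Qed.

(** [b - 1] is the ceiling of the largest fraction. *)
Lemma fractran_step_le n : (fractran_step F n)%:Z <= (b - 1) * n%:Z.
Proof.
rewrite /b /fractran_base addrAC subrr add0r.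
elim: (fractions F) (fractions_gt0 F) => [_|x s IHs /= /andP[x0 s0]].
  by rewrite big_nil ceil0 mul0r.
rewrite big_cons; set m := \big[_/_]_(_ <- _) _ in IHs *.
have cle y : y <= Num.max x m -> Num.ceil y * n%:Z <= Num.ceil (Num.max x m) * n%:Z.
  by move=> yx; rewrite ler_wpM2r //; exact: ceil_le.
case: ifP => xn; last by apply: le_trans (IHs s0) (cle _ _); rewrite le_max lexx orbT.
apply: le_trans (cle x _); last by rewrite le_max lexx.
have xn0 : 0 <= x * n%:R by rewrite mulr_ge0 // ltW.
rewrite -(ler_int rat) -pmulrn intrM -pmulrn.
have /natrP[k ek] : x * n%:R \is a Num.nat by rewrite natrEint xn.
rewrite ek natrK -ek ler_wpM2r //; exact: ceil_ge.
Qed.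

(** The map $f_i$: if $n = b_i d + r$ with $r \in [b_i]$, then $n$ and $r$ share their digit, so
    $f_i(n) = d + f_i(r)$. *)
Definition fractran_quotient (i : nat) (n : int) : int :=
  (n %/ fractran_bases F i)%Z
  + fractran_values F i `|(n %% fractran_bases F i)%Z|%N.

Let bi_gt0 i : 0 < fractran_bases F i.
Proof. exact: lt_trans (fractran_bases_gt1 F i). Qed.

Let b_gt1 : 1 < b. Proof. exact: fractran_base_gt1. Qed.

Let biS i : fractran_bases F i.+1 = b * fractran_bases F i.
Proof. by rewrite /fractran_bases exprS. Qed.

Lemma fractran_quotient_digit i n :
  fractran_residues F i (n - fractran_bases F i * fractran_quotient i n).
Proof.
exists `|(n %% fractran_bases F i)%Z|%N => /=; rewrite gez0_abs ?modz_ge0 ?gt_eqF //.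
  by rewrite ltz_pmod.
rewrite /fractran_quotient mulrDr opprD addrA; congr (_ - _).
by rewrite /modz mulrC.
Qed.

Lemma fractran_quotient_small i n : n%:Z <= fractran_bases F i - 2 ->
  fractran_quotient i n = (fractran_step F n)%:Z.
Proof.
move=> n_small; have := bi_gt0 i => b0.
rewrite /fractran_quotient divz_small ?modz_small ?add0r; [|lia..].
rewrite /fractran_values ifF //; lia.
Qed.

Lemma fractran_quotient0 i : fractran_quotient i 0 = 0.
Proof.
rewrite -[0]/(0%N%:Z) fractran_quotient_small ?fractran_step0 //.
have := fractran_bases_gt1 F i; lia.
Qed.

Lemma fractran_complete_orbits :
  additive_system (fractran_collection F) <->
  forall n, exists k, orbit fractran_quotient n k = 0.
Proof.
apply: additive_system_orbits.
- exact: fractran_bases_gt1.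
- by move=> i; have [] := fractran_residuesP F i.
- exact: fractran_quotient_digit.
- exact: fractran_quotient0.
Qed.

(** A Fractran step multiplies by at most $b - 1$ whereas the bases grow by the factor $b$, so the
    orbit stays in the range where $f_i$ is the Fractran step. *)
Lemma orbit_follows_fractran n i m k :
  orbit fractran_quotient n i = m%:Z -> m%:Z <= fractran_bases F i - 2 ->
  orbit fractran_quotient n (k + i) = (iter k (fractran_step F) m)%:Z /\
  (iter k (fractran_step F) m)%:Z <= fractran_bases F (k + i) - 2.
Proof.
move=> nm m_small; elim: k => //= k [-> IHk]; split.
  exact: fractran_quotient_small.
apply: le_trans (fractran_step_le _) _; rewrite biS.
apply: le_trans (ler_wpM2l _ IHk) _; first by move: b_gt1; rewrite /b; lia.
move: b_gt1 (fractran_bases_gt1 F (k + i)); rewrite -/b.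
move: (fractran_bases F (k + i)) => y; clearbody b; nia.
Qed.

Lemma fractran_bases_gt i : i%:Z < fractran_bases F i.
Proof.
elim: i => [|i IHi]; first exact: bi_gt0.
rewrite biS; move: (bi_gt0 i) b_gt1 IHi; nia.
Qed.

(** The upper bound relaxes $(b-1)(b_{i+1}-2)$, which comes from [fractran_step_le]. The index is
    shifted since for $b = 2$ the exceptional value 1 exceeds $b_1 - b_0 - 2 = 0$. *)
Lemma fractran_values_bounds i n :
  0 <= fractran_values F i.+1 `|(n %% fractran_bases F i.+1)%Z|%N
    <= fractran_bases F i.+2 - fractran_bases F i.+1 - 2.
Proof.
have [b0 b1] := (bi_gt0 i, fractran_bases_gt1 F i).
have := ltz_pmod n (bi_gt0 i.+1); have : 0 <= (n %% fractran_bases F i.+1)%Z.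
  by rewrite modz_ge0 // gt_eqF.
case: (n %% _)%Z => // r _; rewrite absz_nat => r_small.
rewrite /fractran_values; case: ifP => [_|/negbT r_neq].
  rewrite !biS; move: b_gt1 b1; nia.
rewrite (le_trans (fractran_step_le r)) ?andbT // biS.
have : r%:Z <= fractran_bases F i.+1 - 2 by lia.
move: b_gt1; nia.
Qed.

(** Up to an error of at most [|o 1|], the orbit stays between 0 and the current base. Once the base
    exceeds this error, dividing by it gives a floor between -1 and 1, for which
    [fractran_values_bounds] leaves room. *)
Lemma orbit_enters_window n : exists i,
  -1 <= orbit fractran_quotient n i <= fractran_bases F i - 2.
Proof.
set o := orbit _ n.
have oS i : o i.+1 = fractran_quotient i (o i) by [].
have b_gt0 i : 1 < fractran_bases F i by exact: fractran_bases_gt1.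
have lower i : - `|o 1%N| <= o i.+1.
  elim: i => [|i IHi]; first lia.
  have /andP[v0 _] := fractran_values_bounds i (o i.+1).
  suff : - `|o 1%N| <= (o i.+1 %/ fractran_bases F i.+1)%Z.
    by rewrite (oS i.+1) /fractran_quotient; lia.
  rewrite lez_divRL //; apply: le_trans IHi; rewrite mulNr lerN2.
  by rewrite ler_peMr // ltW.
have upper i : o i.+1 <= `|o 1%N| + fractran_bases F i.+1.
  elim: i => [|i IHi]; first by have := bi_gt0 1; lia.
  have /andP[_ v1] := fractran_values_bounds i (o i.+1).
  suff : (o i.+1 %/ fractran_bases F i.+1)%Z <= `|o 1%N| + 1.
    by rewrite (oS i.+1) /fractran_quotient; have := b_gt0 i.+1; lia.
  rewrite -ltzD1 ltz_divLR //.
  move: (b_gt0 i.+1) IHi; move: (fractran_bases _ _) => y.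
  have : 0 <= `|o 1%N| by [].
  nia.
have [j oj_small] : exists j, `|o 1%N| < fractran_bases F j.+1.
  by exists (absz (o 1%N)); rewrite (lt_trans _ (fractran_bases_gt _)) //; lia.
have /andP[v0 v1] := fractran_values_bounds j (o j.+1).
exists j.+2; rewrite (oS j.+1) /fractran_quotient; apply/andP; split.
  suff : -1 <= (o j.+1 %/ fractran_bases F j.+1)%Z by lia.
  by rewrite lez_divRL //; have := lower j; lia.
suff : (o j.+1 %/ fractran_bases F j.+1)%Z < 2 by have := b_gt0 j.+1; lia.
by rewrite ltz_divLR //; have := upper j; lia.
Qed.

(** A multiple of $b_i$ has digit 0, so $x b_i$ is a preimage of $x$ under $f_i$. *)
Lemma orbit_surjective i x : exists n, orbit fractran_quotient n i = x.
Proof.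
elim: i x => [|i IHi] x; first by exists x.
have [n nx] := IHi (x * fractran_bases F i); exists n => /=.
rewrite nx /fractran_quotient mulzK ?gt_eqF // modzMl.
rewrite -/(fractran_values F i 0) /fractran_values fractran_step0 ifF ?addr0 //.
by rewrite lt_eqF // subr_gt0 fractran_bases_gt1.
Qed.

(** The purpose of the exceptional value: $-1$ has remainder $b_i - 1$ and integer quotient $-1$,
    which the value 1 cancels. *)
Lemma fractran_quotientN1 i : fractran_quotient i (-1) = 0.
Proof.
have -> : -1 = (-1) * fractran_bases F i + (fractran_bases F i - 1) by lia.
have b0 := bi_gt0 i.
rewrite /fractran_quotient divzMDl ?gt_eqF // modzMDl.
rewrite divz_small ?modz_small; [|lia..].
by rewrite /fractran_values gez0_abs ?eqxx; lia.
Qed.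

Lemma fractran_complete_halting :
  additive_system (fractran_collection F) <->
  forall n, exists k, iter k (fractran_step F) n = 0%N.
Proof.
rewrite fractran_complete_orbits; split=> [vanish m|halt n].
  (* The bases outgrow their indices, so at index [m + 2] the window contains [m]. *)
  have m_small : m%:Z <= fractran_bases F m.+2 - 2.
    by have := fractran_bases_gt m.+2; lia.
  have [n nm] := orbit_surjective m.+2 m; have [k nk] := vanish n; exists k.
  have [e _] := orbit_follows_fractran k nm m_small.
  apply/eqP; rewrite -eqz_nat -e; apply/eqP.
  by rewrite (orbit_vanishes fractran_quotient0 nk) // leq_addr.
have [i /andP[]] := orbit_enters_window n; set x := orbit _ n i.
rewrite le_eqVlt => /predU1P[xN1 _|x0 x_small].
  by exists i.+1; rewrite /= -/x -xN1 fractran_quotientN1.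
have xm : x = `|x|%N by lia.
have [k mk] := halt (absz x); exists (k + i)%N.
by have [-> _] := orbit_follows_fractran k xm ltac:(lia); rewrite mk.
Qed.

End FractranCollections.

(** * A loop language computing mu-recursive functions *)

(** [Loop] tests its register anew before each pass, so the body may refill it; this allows
    unbounded search. The increments of one [Add] will later form a single fraction. *)
Inductive cmd : Type :=
| Add of seq nat
| Then of cmd & cmd
| Loop of nat & cmd.

Definition store := nat -> nat.

Definition increment (x : store) (s : seq nat) : store :=
  fun i => x i + count_mem i s.

Definition decrement (x : store) (r : nat) : store :=
  fun i => if i == r then (x i).-1 else x i.

Inductive exec : cmd -> store -> store -> Prop :=
| exec_Add s x : exec (Add s) x (increment x s)
| exec_Then c c' x y z : exec c x y -> exec c' y z -> exec (Then c c') x z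
| exec_Loop_stop r c x : x r = 0 -> exec (Loop r c) x x
| exec_Loop_step r c x y z :
    0 < x r -> exec c (decrement x r) y -> exec (Loop r c) y z ->
    exec (Loop r c) x z.

Definition runs c x (Q : store -> Prop) := exists2 y, exec c x y & Q y.

Lemma runs_Then c c' x (P Q : store -> Prop) :
  runs c x P -> (forall y, P y -> runs c' y Q) -> runs (Then c c') x Q.
Proof. by move=> [y xy Py] /(_ _ Py)[z yz Qz]; exists z => //; exact: exec_Then yz. Qed.

Lemma runs_weaken c x (P Q : store -> Prop) :
  runs c x P -> (forall y, P y -> Q y) -> runs c x Q.
Proof. by move=> [y xy Py] /(_ _ Py); exists y. Qed.

(** The index of the invariant [I] is a variant: it drops in each pass and so forces termination. *)
Lemma runs_Loop r c (I : nat -> store -> Prop) m x :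
  I m x ->
  (forall m y, I m y -> 0 < y r ->
     runs c (decrement y r) (fun z => exists2 n, n < m & I n z)) ->
  runs (Loop r c) x (fun y => y r = 0 /\ exists n, I n y).
Proof.
move=> + body; elim/ltn_ind: m x => m IHm x Ix.
have [r0|r_gt0] := posnP (x r).
  by exists x; [exact: exec_Loop_stop | split=> //; exists m].
have [y xy [n nm Iy]] := body m x Ix r_gt0.
have [z yz Qz] := IHm n nm y Iy.
by exists z => //; exact: exec_Loop_step xy yz.
Qed.

Lemma runs_move r s x : r \notin s ->
  runs (Loop r (Add s)) x (fun y =>
    forall i, y i = if i == r then 0 else x i + x r * count_mem i s).
Proof.
move=> rs; pose I n (y : store) := y r = n /\
  forall i, i != r -> y i + n * count_mem i s = x i + x r * count_mem i s.
apply: (@runs_weaken _ _ (fun y => y r = 0 /\ exists n, I n y)).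
  apply: (@runs_Loop _ _ _ (x r)) => // _ y [<- yI] r_gt0.
  exists (increment (decrement y r) s); first exact: exec_Add.
  exists (y r).-1; first by rewrite prednK.
  split=> [|i ir]; first by rewrite /increment /decrement eqxx (count_memPn rs) addn0.
  rewrite -yI // /increment /decrement (negPf ir); nia.
move=> y [yr [n []]]; rewrite yr => <- yI i; case: eqP => [->|/eqP/yI] //.
by rewrite addn0.
Qed.

Definition copy r o t :=
  Then (Loop o (Add [::])) (Then (Loop t (Add [::]))
    (Then (Loop r (Add [:: o; t])) (Loop t (Add [:: r])))).

Lemma runs_copy r o t x : uniq [:: r; o; t] ->
  runs (copy r o t) x (fun y =>
    y o = x r /\ forall i, i != o -> i != t -> y i = x i).
Proof.
rewrite /= !inE negb_or !andbT => /andP[/andP[ro rt] ot].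
apply: (runs_Then (runs_move x _)) => // x1 x1E.
apply: (runs_Then (runs_move x1 _)) => // x2 x2E.
apply: (runs_Then (runs_move x2 _)) => [|x3 x3E]; first by rewrite !inE negb_or ro.
apply: runs_weaken (runs_move x3 _) _ => [|y yE]; first by rewrite inE eq_sym.
have H i : y i = if i == o then x r else if i == t then 0 else x i.
  rewrite yE !x3E !x2E !x1E /= !(eq_sym _ i).
  by move: ro rt ot; do !case: eqP => // *; subst => //; lia.
split; first by rewrite H eqxx.
by move=> i io it; rewrite H (negPf io) (negPf it).
Qed.

(* The arguments are read from the registers [ins], the value is written to
   [o], and the registers from [k] on serve as scratch space. *)
Fixpoint compile n (f : murec n) (ins : seq nat) (o k : nat) : cmd :=
  match f with
  | Zero => Loop o (Add [::])
  | Succ => Then (copy (head 0 ins) o k) (Add [:: o])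
  | Proj _ i => copy (nth 0 ins i) o k
  | Comp m _ g h =>
      Then (foldr (fun i => Then (compile (h i) ins (k + i) (k + m)))
                  (Add [::]) (enum 'I_m))
           (compile g (iota k m) o (k + m))
  | Prec _ g h =>
      Then (compile g (behead ins) k.+1 k.+4)
     (Then (Loop k (Add [::]))
     (Then (copy (head 0 ins) k.+2 k.+3)
     (Then (Loop k.+2
             (Then (compile h [:: k, k.+1 & behead ins] k.+3 k.+4)
             (Then (copy k.+3 k.+1 k.+4) (Add [:: k]))))
           (copy k.+1 o k.+3))))
  | Mu _ g =>
      let eval_g := compile g (k :: ins) k.+1 k.+2 in
      Then (Loop k (Add [::]))
     (Then eval_g
     (Then (Loop k.+1 (Then (Add [:: k]) eval_g))
           (copy k o k.+1)))
  end.

(** * Correctness of the compilation *)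

Definition agree_below k o (x y : store) :=
  forall r, r < k -> r != o -> y r = x r.

Lemma map_agree k o (x y : store) s : agree_below k o x y ->
  all (fun r => r < k) s -> o \notin s -> map y s = map x s.
Proof.
move=> xy /allP s_k os; apply/eq_in_map => r rs.
by apply: xy; [exact: s_k | apply: contraNneq os => <-].
Qed.

(** The frame condition in the conclusion lets arguments and intermediate values survive the calls
    of subprograms, whose scratch space starts above them. *)
Lemma compile_correct n (f : murec n) v y : murec_eval f v y ->
  forall ins o k x, tval v = map x ins -> all (fun r => r < k) ins ->
  o < k -> o \notin ins ->
  runs (compile f ins o k) x (fun z => z o = y /\ agree_below k o x z).
Proof.
elim: f v y => {n} /= [v _ ->|v _ ->|n i v _ ->
  |m n g IHg h IHh v y [w hw gw]
  |n g IHg h IHh v y [s [g0 hs ->]]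
  |n g IHg v y [gy g_lt]] ins o k x vE ins_k ok o_ins.
- apply: runs_weaken (runs_move x _) _ => // z zE.
  by split=> [|r _ ro]; rewrite zE ?eqxx // (negPf ro) muln0 addn0.
- have : size ins = 1 by rewrite -(size_map x) -vE size_tuple.
  case: ins vE ins_k o_ins => [|r []] //= vE; rewrite andbT inE => rk ro _.
  have {}vE : thead v = x r by rewrite /thead (tnth_nth 0) vE.
  apply: (runs_Then (runs_copy x _)) => [|z [zo zr]].
    by rewrite /= !inE eq_sym (negPf ro) !ltn_eqF.
  eexists; first exact: exec_Add.
  rewrite /increment /= eqxx zo vE addn0 addn1; split=> // i ik io.
  by rewrite (eq_sym o) (negPf io) !addn0 zr // ltn_eqF.
- have ri : nth 0 ins i \in ins.
    by rewrite mem_nth // -(size_map x) -vE size_tuple.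
  apply: runs_weaken (runs_copy x _) _ => [|z [zo zr]].
    rewrite /= !inE [in X in _ && X](ltn_eqF ok) (ltn_eqF (allP ins_k _ ri)) ?orbF ?andbT.
    by apply: contraNneq o_ins => <-.
  split=> [|r rk ro]; last by rewrite zr // ltn_eqF.
  by rewrite zo (tnth_nth 0) vE (nth_map 0) // -(size_map x) -vE size_tuple.
- have ins_km : all (fun r => r < k + m) ins.
    by apply: sub_all ins_k => r rk; rewrite ltn_addr.
  pose P (s : seq 'I_m) z u := (forall i : 'I_m, i \in s -> u (k + i) = tnth w i)
    /\ forall r, r < k + m -> (forall i : 'I_m, i \in s -> r != k + i) -> u r = z r.
  have args s z : tval v = map z ins ->
      runs (foldr (fun i => Then (compile (h i) ins (k + i) (k + m))) (Add [::]) s)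
        z (P s z).
    elim: s z => [|i s IHs] z vz /=.
      exists (increment z [::]); first exact: exec_Add.
      by split=> // r _ _; rewrite /increment addn0.
    have ki_ins : k + i \notin ins.
      by apply/negP => /(allP ins_k); rewrite ltnNge leq_addr.
    have ki_lt : k + i < k + m by rewrite ltn_add2l.
    apply: (runs_Then (IHh i _ _ (hw i) _ _ _ _ vz ins_km ki_lt ki_ins)) => z1 [z1i z1E].
    apply: runs_weaken (IHs z1 _) _ => [|u [us uE]].
      by rewrite vz; apply/esym/(map_agree z1E).
    split=> [j|r rkm rs]; last first.
      rewrite uE // => [|j js]; last by rewrite rs // inE js orbT.
      by rewrite z1E // rs // inE eqxx.
    rewrite inE; have [js _|js] := boolP (j \in s); first exact: us.
    rewrite orbF => /eqP ji; rewrite ji in js *; rewrite uE // => l ls.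
    by rewrite eqn_add2l; apply: contraNneq js => /val_inj ->.
  apply: (runs_Then (args _ x vE)) => z [zw zk].
  have {}zk r : r < k -> z r = x r.
    move=> rk; rewrite zk ?ltn_addr // => i _.
    by rewrite ltn_eqF // ltn_addr.
  apply: runs_weaken (IHg _ _ gw _ _ _ z _ _ _ _) _ => [||||u [uo ur]].
  - apply: (@eq_from_nth _ 0) => [|i]; rewrite size_tuple ?size_map ?size_iota // => im.
    rewrite (nth_map 0) ?size_iota // nth_iota //.
    by rewrite (zw (Ordinal im)) ?mem_enum // (tnth_nth 0).
  - by apply/allP => r; rewrite mem_iota => /andP[].
  - by rewrite ltn_addr.
  - by rewrite mem_iota leqNgt ok.
  by split=> // r rk ro; rewrite ur ?zk // ltn_addr.
- have head_ins : ins = head 0 ins :: behead ins.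
    have : size ins = n.+1 by rewrite -(size_map x) -vE size_tuple.
    by case: (ins).
  set c0 := head 0 ins in head_ins *; set ins' := behead ins in head_ins *.
  have v0 : thead v = x c0 by rewrite /thead (tnth_nth 0) vE head_ins.
  have v' : tval (behead_tuple v) = map x ins' by rewrite /= vE head_ins.
  have /andP[c0k ins'_k] : (c0 < k) && all (fun r => r < k) ins'.
    by rewrite -[_ && _]/(all _ (_ :: _)) -head_ins.
  have ins'_lt j : k <= j -> all (fun r => r < j) ins'.
    by move=> kj; apply: sub_all ins'_k => r /leq_trans ->.
  have ins'_notin j : k <= j -> j \notin ins'.
    by move=> kj; apply/negP => /(allP ins'_k); rewrite ltnNge kj.
  apply: (runs_Then (IHg _ _ g0 _ k.+1 k.+4 _ v' _ _ _)).
  - by apply: ins'_lt; lia.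
  - lia.
  - by apply: ins'_notin; lia.
  move=> z1 [z1s z1x].
  apply: (runs_Then (runs_move z1 _)) => // z2 z2E.
  apply: (runs_Then (runs_copy z2 _)) => [|z3 [z3c z3E]].
    by rewrite /= !inE; lia.
  pose T := thead v.
  (* Register [k.+2] counts the remaining passes, [k] holds the recursion index and [k.+1] the value
     reached so far. *)
  pose I m u := [/\ u k.+2 = m, m <= T, u k = T - m, u k.+1 = s (T - m) &
    forall r, r < k -> u r = x r].
  apply: (runs_Then (@runs_Loop _ _ I T z3 _ _)).
  - have z3k : z3 k = 0 by rewrite z3E ?z2E ?eqxx //; lia.
    have z3E1 r : r < k.+2 -> r != k -> z3 r = z1 r.
      move=> rk rk'; rewrite z3E; [|lia..].
      by rewrite z2E (negPf rk') muln0 addn0.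
    have z3x r : r < k -> z3 r = x r by move=> rk; rewrite z3E1 ?z1x //; lia.
    split=> //; rewrite ?subnn //; last by rewrite z3E1 ?z1s //; lia.
    rewrite z3c z2E ifF; last by apply/eqP => e; move: c0k; rewrite e ltnn.
    by rewrite muln0 addn0 z1x ?v0 //; lia.
  - move=> m u [uc mT uk us ux] m_gt0; rewrite uc in m_gt0.
    pose u' := decrement u k.+2.
    have u'E r : r != k.+2 -> u' r = u r by rewrite /u' /decrement => /negPf->.
    have hs' : murec_eval h [tuple of u' k :: u' k.+1 :: behead_tuple v] (s (T - m).+1).
      by rewrite !u'E ?us ?uk; [apply: hs; lia | lia..].
    have w_args : tval [tuple of u' k :: u' k.+1 :: behead_tuple v]
        = map u' (k :: k.+1 :: ins').
      rewrite /= v' /=; congr [:: _, _ & _]; apply/esym/eq_in_map => r /(allP ins'_k) rk.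
      by rewrite u'E ?ux //; lia.
    apply: (runs_Then (IHh _ _ hs' _ k.+3 k.+4 u' w_args _ _ _)).
    + by rewrite /= ins'_lt ?andbT; lia.
    + lia.
    + by rewrite !inE !negb_or ins'_notin ?andbT; lia.
    move=> u1 [u1t u1E].
    apply: (runs_Then (runs_copy u1 _)) => [|u2 [u2a u2E]].
      by rewrite /= !inE; lia.
    eexists; first exact: exec_Add.
    have u2u r : r < k.+4 -> r != k.+1 -> r != k.+2 -> r != k.+3 -> u2 r = u r.
      by move=> *; rewrite u2E ?u1E ?u'E //; lia.
    have u2c : u2 k.+2 = m.-1.
      rewrite u2E ?u1E; [|lia..].
      by rewrite /u' /decrement eqxx uc.
    exists m.-1; first by rewrite prednK.
    split=> [||||r rk]; rewrite /increment /=.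
    + by rewrite u2c; lia.
    + lia.
    + rewrite u2u ?uk; [|lia..]; rewrite eqxx; lia.
    + rewrite u2a u1t; have -> : T - m.-1 = (T - m).+1 by lia.
      lia.
    by rewrite u2u ?ux //; lia.
  move=> u [u_c [m [um mT uk us ux]]].
  have m0 : m = 0 by rewrite -um.
  apply: runs_weaken (runs_copy u _) _ => [|u' [u'o u'E]].
    by rewrite /= !inE; lia.
  rewrite u'o us m0 subn0; split=> // r rk ro; rewrite u'E ?ux //; lia.
(* [m] is the distance from the candidate in [k] to the least zero [y]; register [k.+1] holds the
   value of [g] at the candidate. *)
- pose I m u := [/\ m <= y, u k = y - m, murec_eval g [tuple of y - m :: v] (u k.+1) &
    forall r, r < k -> u r = x r].
  have eval_g z m : m <= y -> z k = y - m -> (forall r, r < k -> z r = x r) ->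
      runs (compile g (k :: ins) k.+1 k.+2) z (I m).
    move=> my zk zx.
    have [c gc] : exists c, murec_eval g [tuple of y - m :: v] c.
      have [->|m_gt0] := posnP m; first by exists 0; rewrite subn0.
      by have [|c gc] := g_lt (y - m); [lia | exists c.+1].
    apply: runs_weaken (IHg _ _ gc (k :: ins) k.+1 k.+2 z _ _ _ _) _.
    + rewrite /= zk vE; congr (_ :: _); apply/esym/eq_in_map => r /(allP ins_k) rk.
      by rewrite zx.
    + by rewrite /=; apply/andP; split=> //; apply: sub_all ins_k => r; lia.
    + lia.
    + by rewrite inE negb_or; apply/andP; split; [lia | apply/negP => /(allP ins_k); lia].
    move=> u [u_c uE]; split=> //; first by rewrite uE //; lia.
      by rewrite u_c.
    by move=> r rk; rewrite uE ?zx //; lia.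
  apply: (runs_Then (runs_move x _)) => // z1 z1E.
  apply: (runs_Then (eval_g z1 y _ _ _)) => [|||z2 Iz2] //.
    by rewrite z1E eqxx subnn.
    by move=> r rk; rewrite z1E ltn_eqF // muln0 addn0.
  apply: (runs_Then (@runs_Loop _ _ I y z2 Iz2 _)).
    move=> m u [my uk gu ux] u_gt0.
    have m_gt0 : 0 < m.
      rewrite lt0n; apply/eqP => m0; move: gu; rewrite m0 subn0 => /(murec_eval_fun gy).
      by move: u_gt0; lia.
    eapply runs_Then.
      by eexists; [exact: exec_Add | exact: erefl].
    move=> _ <-; apply: runs_weaken (eval_g _ m.-1 _ _ _) _ => [|||u' Iu'].
    + lia.
    + by rewrite /increment /decrement /= eqxx ltn_eqF // uk; lia.
    + by move=> r rk; rewrite /increment /decrement /= ltn_eqF ?(gtn_eqF rk) ?ux //; lia.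
    by exists m.-1; first by rewrite prednK.
  move=> u [u0 [m [my uk gu ux]]].
  have m0 : m = 0.
    apply/eqP; rewrite -leqn0 leqNgt; apply/negP => m_gt0.
    have [|c gc] := g_lt (y - m); first lia.
    by have := murec_eval_fun gu gc; rewrite u0.
  apply: runs_weaken (runs_copy u _) _ => [|u' [u'o u'E]].
    by rewrite /= !inE; lia.
  by rewrite u'o uk m0 subn0; split=> // r rk ro; rewrite u'E ?ux //; lia.
Qed.

(** * Label machines *)

Section PartialIteration.
Variables (T : Type) (f : T -> option T).

Definition reaches x y := exists n, iter n (obind f) (Some x) = Some y.
Definition halts x := exists n, iter n (obind f) (Some x) = None.

Lemma iter_None n : iter n (obind f) None = None.
Proof. by elim: n => //= n ->. Qed.

Lemma reaches_refl x : reaches x x.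
Proof. by exists 0. Qed.

Lemma reaches_trans y x z : reaches x y -> reaches y z -> reaches x z.
Proof. by move=> [m xy] [n yz]; exists (n + m); rewrite iterD xy. Qed.

Lemma reaches_step x y : f x = Some y -> reaches x y.
Proof. by exists 1. Qed.

Lemma reaches_halts x y : reaches x y -> halts y -> halts x.
Proof. by move=> [m xy] [n yn]; exists (n + m); rewrite iterD xy. Qed.

(** The invariant only has to recur after at least one step; strong induction on the supposed
    halting time refutes it. *)
Lemma diverges (I : T -> Prop) x :
  (forall x, I x -> exists y z, [/\ f x = Some y, reaches y z & I z]) ->
  I x -> ~ halts x.
Proof.
move=> next Ix [n]; elim/ltn_ind: n x Ix => -[//|n] IHn x /next[y [z [xy [k yz] Iz]]].
rewrite iterSr /= xy; have [nk|/ltnW kn] := leqP n k.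
  by move=> yn; move: yz; rewrite -(subnK nk) iterD yn iter_None.
rewrite -(subnK kn) iterD yz; apply: IHn Iz; exact: leq_subr.
Qed.

End PartialIteration.

Inductive instr : Type :=
| Inc of seq nat & nat
| Dec of nat & nat & nat.

(* A jump from a label to itself halts: as a fraction it would not be in lowest
   terms. In particular control halts outside of the program, where the default
   instruction of [nth] is such a jump. *)
Definition machine_step (P : seq instr) (c : nat * store) : option (nat * store) :=
  let: (l, x) := c in
  match nth (Inc [::] l) P l with
  | Inc s t => if t == l then None else Some (t, increment x s)
  | Dec r t t' =>
      if 0 < x r then if t == l then None else Some (t, decrement x r)
      else if t' == l then None else Some (t', x)
  end.

Fixpoint code_size c :=
  match c with
  | Add _ => 1
  | Then c c' => code_size c + code_size c'
  | Loop _ c => (code_size c).+1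
  end.

(* The code of [c] to be placed at label [l], exiting to label [k]. *)
Fixpoint assemble c l k :=
  match c with
  | Add s => [:: Inc s k]
  | Then c c' =>
      assemble c l (l + code_size c) ++ assemble c' (l + code_size c) k
  | Loop r c => Dec r l.+1 k :: assemble c l.+1 l
  end.

Lemma size_assemble c l k : size (assemble c l k) = code_size c.
Proof.
elim: c l k => //= [c IHc c' IHc' l k|r c IHc l k]; last by rewrite IHc.
by rewrite size_cat IHc IHc'.
Qed.

Lemma nth_assemble d (pre post : seq instr) i : nth d (pre ++ i :: post) (size pre) = i.
Proof. by rewrite nth_cat ltnn subnn. Qed.

(** An exit label outside the block rules out jumps from a label to itself, which would halt. It may
    precede the block, as it does for the body of a loop. *)
Lemma assemble_correct c x y : exec c x y -> forall pre post k,
  (k < size pre) || (size pre + code_size c <= k) ->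
  reaches (machine_step (pre ++ assemble c (size pre) k ++ post))
    (size pre, x) (k, y).
Proof.
elim=> {c x y} [s x|c c' x y z _ IHc _ IHc'|r c x xr
  |r c x y z xr _ IHc _ IHl] pre post k /= k_out.
- apply: reaches_step; rewrite /machine_step nth_assemble ifF //; lia.
- apply: reaches_trans.
    rewrite -catA; apply: IHc; lia.
  have := IHc' (pre ++ assemble c (size pre) (size pre + code_size c)) post k.
  rewrite size_cat size_assemble -!catA; apply; lia.
- apply: reaches_step; rewrite /machine_step nth_assemble xr /= ifF //; lia.
- apply: (@reaches_trans _ _ ((size pre).+1, decrement x r)).
    apply: reaches_step; rewrite /machine_step nth_assemble xr ifF //; lia.
  apply: reaches_trans (IHl _ _ _ k_out) => /=.
  have := IHc (rcons pre (Dec r (size pre).+1 k)) post (size pre).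
  by rewrite size_rcons -cats1 -!catA /= ltnSn; apply.
Qed.

Definition program c := assemble c 0 (code_size c).

Lemma program_halts c x y : exec c x y ->
  reaches (machine_step (program c)) (0, x) (size (program c), y).
Proof.
move=> xy; have := assemble_correct xy (pre := [::]) [::] (k := code_size c).
by rewrite cats0 /program size_assemble add0n leqnn; apply.
Qed.

(** The appended loop restores the register it tests, so control alternates between its two labels
    forever. *)
Lemma program_diverges c r x y : exec c x y -> 0 < y r ->
  ~ halts (machine_step (program (Then c (Loop r (Add [:: r]))))) (0, x).
Proof.
move=> xy yr; set P := program _.
pose l := code_size c.
have [n0 n1] : nth (Inc [::] l) P l = Dec r l.+1 (l + 2) /\
    nth (Inc [::] l.+1) P l.+1 = Inc [:: r] l.
  rewrite /P /program /= !nth_cat !size_assemble /= -/l add0n ltnn subnn.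
  by rewrite ltnNge leqnSn /= subSn // subnn.
have run : reaches (machine_step P) (0, x) (l, y).
  have := assemble_correct xy (pre := [::]) 
    (assemble (Loop r (Add [:: r])) l (l + 2)) (k := l).
  by rewrite /P /program /=; apply; rewrite leqnn.
have div : ~ halts (machine_step P) (l, y).
  apply: (@diverges _ _ (fun c => c.1 = l.+1 \/ c.1 = l /\ 0 < c.2 r)); last by right.
  move=> [l' z] /= [->|[-> zr]].
    exists (l, increment z [:: r]), (l, increment z [:: r]).
    split; [|exact: reaches_refl|right; split=> //=].
      by rewrite n1 ltn_eqF.
    by rewrite /increment /= eqxx; lia.
  exists (l.+1, decrement z r), (l.+1, decrement z r).
  split; [|exact: reaches_refl|by left].
  by rewrite n0 zr gtn_eqF.
move=> [n hn]; apply: div; have [m xm] := run; exists n.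
have [nm|mn] := leqP n m.
  by move: xm; rewrite -(subnK nm) iterD hn iter_None.
by rewrite -xm -iterD addnC iterD hn iter_None.
Qed.

(** * Fueled simulation by prioritized rules *)

(* A rule [(s, t)] stands for the fraction with numerator the product of the
   primes indexed by [t] and denominator the product of those indexed by [s];
   a store lists the exponents of the current number. *)
Definition rule := (seq nat * seq nat)%type.

(** The denominator is squarefree and prime to the numerator. *)
Definition reduced (rho : rule) := uniq rho.1 && ~~ has (mem rho.1) rho.2.

Definition enabled (rho : rule) (x : store) := all (fun i => 0 < x i) rho.1.

Definition fire (rho : rule) (x : store) : store :=
  fun i => x i - (i \in rho.1) + count_mem i rho.2.

Fixpoint rules_step (rs : seq rule) (x : store) : option store :=
  if rs is rho :: rs' then
    if enabled rho x then Some (fire rho x) else rules_step rs' x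
  else None.

Lemma rules_step_cat rs rs' x :
  rules_step (rs ++ rs') x =
  if rules_step rs x is Some y then Some y else rules_step rs' x.
Proof. by elim: rs => //= rho rs ->; case: ifP. Qed.

Lemma rules_step_Some rs x y : rules_step rs x = Some y ->
  exists rho, [/\ rho \in rs, enabled rho x & y = fire rho x].
Proof.
elim: rs => //= rho rs IHrs; case: ifP => [rx [<-]|_ /IHrs[rho' [rs' rx' ->]]].
  by exists rho; rewrite mem_head.
by exists rho'; rewrite inE rs' orbT.
Qed.

Lemma rules_step_None rs x :
  (forall rho, rho \in rs -> ~~ enabled rho x) <-> rules_step rs x = None.
Proof.
elim: rs => //= rho rs IHrs; split=> [H|].
  rewrite (negPf (H _ (mem_head _ _))); apply/IHrs => rho' rs'.
  by apply: H; rewrite inE rs' orbT.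
by case: ifP => // /negbT rx /IHrs H rho'; rewrite inE => /predU1P[->|/H].
Qed.

Lemma rules_step_flatten (g : nat -> seq rule) l s x : l \in s ->
  (forall l', l' \in s -> l' != l -> rules_step (g l') x = None) ->
  rules_step (flatten (map g s)) x = rules_step (g l) x.
Proof.
elim: s => // l' s IHs; rewrite inE /= rules_step_cat => ls H.
have [el|l'l] := eqVneq l' l.
  rewrite el; case E: (rules_step (g l) x) => //.
  have [{}ls|ls'] := boolP (l \in s).
    by rewrite IHs // => k ks; apply: H; rewrite inE ks orbT.
  apply/rules_step_None => rho /flatten_mapP[k ks].
  have /rules_step_None : rules_step (g k) x = None; last exact.
  by apply: H; [rewrite inE ks orbT | apply: contraNneq ls' => <-].
rewrite H ?mem_head // IHs // => [|k ks]; last by apply: H; rewrite inE ks orbT.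
by move: ls; rewrite eq_sym (negPf l'l).
Qed.

(** Serves as a termination measure and, with all weights 1, as a count of control tokens. A store
    may have infinite support, hence the list [ix]. *)
Definition mass (ix : seq nat) (w : nat -> nat) (x : store) :=
  \sum_(i <- ix) w i * x i.

Lemma sum_count (ix : seq nat) (w : nat -> nat) (s : seq nat) : uniq ix ->
  \sum_(i <- ix) w i * count_mem i s = \sum_(i <- s | i \in ix) w i.
Proof.
move=> uix; elim: s => [|j s IHs] /=.
  by rewrite big_nil big1_seq // => i _; rewrite muln0.
have one : \sum_(i <- ix) w i * (j == i) = if j \in ix then w j else 0.
  have [jx|jx] := boolP (j \in ix).
    rewrite (bigD1_seq j) //= eqxx muln1 big1 ?addn0 // => i.
    by rewrite eq_sym => /negPf->; rewrite muln0.
  rewrite big1_seq // => i /andP[_ ix_i].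
  by rewrite (_ : j == i = false) ?muln0 //; apply: contraNF jx => /eqP->.
under eq_bigr do rewrite mulnDr.
by rewrite big_split big_cons -IHs one; case: ifP.
Qed.

Lemma mass_fire ix w rho x : uniq ix -> uniq rho.1 -> enabled rho x ->
  mass ix w (fire rho x) + \sum_(i <- rho.1 | i \in ix) w i =
  mass ix w x + \sum_(i <- rho.2 | i \in ix) w i.
Proof.
move=> uix u1 /allP ex; rewrite -!sum_count // /mass -!big_split /=.
apply: eq_bigr => i _; rewrite -!mulnDr /fire (count_uniq_mem _ u1); congr (_ * _).
case: (boolP (i \in rho.1)) => [/ex xi|_] /=; lia.
Qed.

(* [start] triggers the initialization, each machine step turns one [fuel] into
   one [ash], [reset] drives the restart after the fuel has run out, [reg r]
   counts register [r], and [lab l] marks the current label. *)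
Definition start := 0.
Definition fuel := 1.
Definition ash := 2.
Definition reset := 3.
Definition reg r := r.*2 + 4.
Definition lab l := l.*2 + 5.

Lemma lab_reg l r : (lab l == reg r) = false.
Proof. by rewrite /lab /reg; lia. Qed.

Lemma lab_lab l l' : (lab l == lab l') = (l == l').
Proof. by rewrite /lab; lia. Qed.

Lemma reg_reg r r' : (reg r == reg r') = (r == r').
Proof. by rewrite /reg; lia. Qed.

Lemma lab_const l i : i <= reset -> (lab l == i) = false.
Proof. by rewrite /lab /reset; lia. Qed.

Lemma reg_const r i : i <= reset -> (reg r == i) = false.
Proof. by rewrite /reg /reset; lia. Qed.

(* The conditional equations come last, as they also match [reg r == lab l]. *)
Definition tokenE := (lab_lab, lab_reg,
  fun r l => etrans (eq_sym (reg r) (lab l)) (lab_reg l r),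
  reg_reg, lab_const, reg_const,
  fun l i (lei : i <= reset) => etrans (eq_sym i (lab l)) (lab_const l lei),
  fun l i (lei : i <= reset) => etrans (eq_sym i (reg l)) (reg_const l lei)).

Lemma count_reg r s : count_mem (reg r) (map reg s) = count_mem r s.
Proof. by rewrite count_map; apply: eq_count => i /=; rewrite reg_reg. Qed.

Lemma count_nonreg i s : (forall r, reg r != i) -> count_mem i (map reg s) = 0.
Proof.
by move=> ir; apply/count_memPn/mapP => -[r _ ri]; move: (ir r); rewrite ri eqxx.
Qed.

Section Rules.
Variables (P : seq instr) (e : nat).

Let L := size P.

Definition instr_registers i :=
  match i with Inc s _ => s | Dec r _ _ => [:: r] end.

Let registers l := instr_registers (nth (Inc [::] l) P l).

Let M := (\max_(r <- flatten (map registers (iota 0 L))) r).+1.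

(** Priority makes the second rule of [Dec] the zero case. The filter drops jumps from a label to
    itself, where the machine halts. *)
Definition instr_rules l : seq rule :=
  filter reduced match nth (Inc [::] l) P l with
  | Inc s t => [:: ([:: lab l; fuel], [:: lab t, ash & map reg s])]
  | Dec r t t' => [:: ([:: lab l; fuel; reg r], [:: lab t; ash]);
                      ([:: lab l; fuel], [:: lab t'; ash])]
  end.

Definition start_rule : rule := ([:: start], lab 0 :: nseq e (reg 0)).

(* The rules in order of priority: initialize; run the machine; once it has
   halted or is out of fuel, clear the registers; trade the label for [reset];
   turn the ash back into fuel; restart with one more unit of fuel. *)
Definition front_tail : seq rule :=
  flatten [seq instr_rules l | l <- iota 0 L]
  ++ [seq ([:: reg r], [::]) | r <- iota 0 M]
  ++ [seq ([:: lab l], [:: reset]) | l <- iota 0 L].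

Definition rules_tail : seq rule :=
  front_tail ++ [:: ([:: ash], [:: fuel]); ([:: reset], [:: start; fuel])].

Definition rules := start_rule :: rules_tail.
Definition front := start_rule :: front_tail.

Lemma rulesE :
  rules = front ++ [:: ([:: ash], [:: fuel]); ([:: reset], [:: start; fuel])].
Proof. by []. Qed.

(** An over-approximation of [front] by shape, for checking invariants rule by rule. *)
Inductive front_spec : rule -> Prop :=
| front_start : front_spec start_rule
| front_inc l s t : l < L -> nth (Inc [::] l) P l = Inc s t ->
    front_spec ([:: lab l; fuel], [:: lab t, ash & map reg s])
| front_dec l r t : l < L -> r < M ->
    front_spec ([:: lab l; fuel; reg r], [:: lab t; ash])
| front_zero l t : l < L -> front_spec ([:: lab l; fuel], [:: lab t; ash])
| front_clear r : r < M -> front_spec ([:: reg r], [::])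
| front_stop l : l < L -> front_spec ([:: lab l], [:: reset]).

Lemma instr_registers_lt l r : r \in registers l -> r < M.
Proof.
have [lL|lL] := ltnP l L; last by rewrite /registers nth_default.
move=> rl; rewrite ltnS; apply: (leq_bigmax_seq (F := id)) => //.
by apply/flatten_mapP; exists l => //; rewrite mem_iota.
Qed.

Lemma frontP rho : rho \in front -> front_spec rho.
Proof.
rewrite inE => /predU1P[->|]; first exact: front_start.
rewrite /front_tail !mem_cat => /or3P[/flatten_mapP[l]|/mapP[r]|/mapP[l]];
  rewrite mem_iota => /andP[_].
- move=> lL; rewrite mem_filter => /andP[_].
  have := @instr_registers_lt l; rewrite /registers.
  case E: (nth _ _ _) => [s t|r t t'] Mr; rewrite !inE.
    by move/eqP->; exact: front_inc.
  case/orP => /eqP->; last exact: front_zero.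
  by apply: front_dec => //; apply: Mr; rewrite mem_head.
- by move=> rM ->; exact: front_clear.
by move=> lL ->; exact: front_stop.
Qed.

Lemma reduced_rules rho : rho \in rules -> reduced rho.
Proof.
rewrite rulesE mem_cat [X in _ || X]inE mem_seq1 => /or3P[|/eqP->//|/eqP->//].
rewrite inE => /predU1P[->|].
  apply/andP; split=> //; apply/hasPn => i; rewrite inE mem_nseq inE.
  by case/predU1P => [->|/andP[_ /eqP->]].
rewrite /front_tail !mem_cat => /or3P[/flatten_mapP[l _]|/mapP[r _ ->]|/mapP[l _ ->]] //.
  by rewrite mem_filter => /andP[].
by rewrite /reduced /= inE /reset /lab; lia.
Qed.

(** Every rule of [front] lowers a weighted count of tokens, so these rules cannot fire forever. *)
Lemma normalize (I : store -> Prop) x :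
  (forall x rho, I x -> front_spec rho -> enabled rho x -> I (fire rho x)) ->
  I x -> exists y,
    [/\ reaches (rules_step rules) x y, I y & rules_step front y = None].
Proof.
move=> I_fire.
pose K := \max_(l <- iota 0 L) size (registers l).
(* One unit of fuel outweighs all that a single instruction produces. *)
pose w i := if i == start then e + 2 else if i == fuel then K + 3
            else if i == reset then 0 else 1.
(* This range contains every token that a rule of [front] consumes. *)
pose ix := iota 0 (L.*2 + M.*2 + 9).
have [n xn] : exists n, mass ix w x < n by exists (mass ix w x).+1.
elim: n x xn => // n IHn x xn Ix.
case E: (rules_step front x) => [y|]; last by exists x; split=> //; exact: reaches_refl.
have [rho [rho_front rho_x yE]] := rules_step_Some E.
have rho_spec := frontP rho_front.
have Iy : I y by rewrite yE; exact: I_fire.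
have decr : mass ix w y < mass ix w x.
  have /andP[u1 _] : reduced rho.
    by apply: reduced_rules; rewrite rulesE mem_cat rho_front.
  have := mass_fire w (iota_uniq _ _ : uniq ix) u1 rho_x; rewrite -yE.
  suff : \sum_(i <- rho.2 | i \in ix) w i < \sum_(i <- rho.1 | i \in ix) w i.
    by move=> lt e12; move: lt; rewrite -(ltn_add2l (mass ix w x)) -e12 ltn_add2r.
  have drop s : \sum_(i <- s | i \in ix) w i <= \sum_(i <- s) w i.
    by rewrite big_mkcond; apply: leq_sum => i _; case: ifP.
  apply: leq_ltn_trans (drop _) _.
  have w_reg r : w (reg r) = 1 by rewrite /w /reg /start /fuel /reset; do !case: eqP; lia.
  have w_lab l : w (lab l) = 1 by rewrite /w /lab /start /fuel /reset; do !case: eqP; lia.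
  have w_regs s : \sum_(i <- map reg s) w i = size s.
    by rewrite big_map -sum1_size; apply: eq_bigr => i _; exact: w_reg.
  have [ws wf wa wr] : [/\ w start = e + 2, w fuel = K + 3, w ash = 1 & w reset = 0].
    by [].
  case: rho_spec => [|l s t lL lP|l r t lL rM|l t lL|r rM|l lL] /=;
    rewrite !(big_cons, big_nil) !mem_iota.
  - have -> : nseq e (reg 0) = map reg (nseq e 0) by rewrite map_nseq.
    by rewrite w_regs size_nseq w_lab ws ifT; rewrite /start; lia.
  - have sK : size s <= K.
      have -> : s = registers l by rewrite /registers lP.
      by apply: (leq_bigmax_seq (F := fun l => size (registers l))); rewrite ?mem_iota.
    rewrite w_regs !w_lab wf wa !ifT; rewrite /lab /fuel; lia.
  - by rewrite !w_lab !w_reg wf wa !ifT; rewrite /lab /fuel /reg; lia.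
  - by rewrite !w_lab wf wa !ifT; rewrite /lab /fuel; lia.
  - by rewrite !w_reg !ifT; rewrite /reg; lia.
  - by rewrite !w_lab wr !ifT; rewrite /lab; lia.
have [|z [yz Iz z_front]] := IHn y _ Iy; first by lia.
exists z; split=> //; apply: reaches_trans yz; apply: reaches_step.
by rewrite rulesE rules_step_cat E.
Qed.

Definition idle (x : store) := [/\ x start = 0, forall r, r < M -> x (reg r) = 0
  & forall l, l < L -> x (lab l) = 0].

Lemma idleP x : rules_step front x = None <-> idle x.
Proof.
split=> [/rules_step_None off|[x0 xr xl]].
  have off1 i s : ([:: i], s) \in front -> x i = 0.
    by move/off; rewrite /enabled /= andbT -eqn0Ngt => /eqP.
  split=> [|r rM|l lL]; first exact: off1 (mem_head _ _).
    apply: (off1 _ [::]); rewrite inE /front_tail !mem_cat.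
    by rewrite (map_f (fun r => ([:: reg r], [::]))) ?orbT // mem_iota.
  apply: (off1 _ [:: reset]); rewrite inE /front_tail !mem_cat.
  by rewrite (map_f (fun l => ([:: lab l], [:: reset]))) ?orbT // mem_iota.
apply/rules_step_None => rho /frontP[|l s t lL _|l r t lL rM|l t lL|r rM|l lL].
all: by rewrite /enabled /= ?x0 ?xl ?xr //.
Qed.

Lemma recover x : idle x -> exists y,
  [/\ reaches (rules_step rules) x y, idle y, y ash = 0,
    y fuel = x fuel + x ash & y reset = x reset].
Proof.
have [n xn] : exists n, x ash = n by exists (x ash).
elim: n x xn => [|n IHn] x xn idle_x.
  by exists x; split=> //; [exact: reaches_refl | rewrite xn addn0].
pose x' := fire ([:: ash], [:: fuel]) x.
have x'E i : i != ash -> i != fuel -> x' i = x i.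
  by rewrite /x' /fire /= inE (eq_sym fuel) => /negPf-> /negPf->; rewrite subn0 !addn0.
have [||y [x'y idle_y ya yf yr]] := IHn x'.
- by rewrite /x' /fire /= xn; lia.
- have [x0 xr xl] := idle_x.
  by split=> [|r rM|l lL]; rewrite x'E ?x0 ?xr ?xl ?tokenE.
exists y; split=> //; last by rewrite yr x'E.
  apply: reaches_trans x'y; apply: reaches_step.
  by rewrite rulesE rules_step_cat (idleP x).2 //= /enabled /= xn.
by rewrite yf /x' /fire /= xn; lia.
Qed.

(** Only labels below [L] are recorded: a machine that has reached [L] leaves a token that no rule
    consumes. *)
Definition represents (c : nat * store) (x : store) :=
  [/\ x start = 0, forall l, l < L -> x (lab l) = (l == c.1)
    & forall r, r < M -> x (reg r) = c.2 r].

Definition input : store := fun i => if i == 0 then e else 0.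

Lemma restart x : idle x -> x ash = 0 -> 0 < x reset -> exists y z,
  [/\ rules_step rules x = Some y, reaches (rules_step rules) y z,
    represents (0, input) z &
    [/\ z ash = 0, z fuel = (x fuel).+1 & z reset = (x reset).-1]].
Proof.
move=> idle_x xa xr; pose y := fire ([:: reset], [:: start; fuel]) x.
have [x0 x_reg x_lab] := idle_x.
have y0 : y start = 1 by rewrite /y /fire x0.
have y_lab l : y (lab l) = x (lab l) by rewrite /y /fire /= !inE !tokenE // subn0 !addn0.
have y_reg r : y (reg r) = x (reg r) by rewrite /y /fire /= !inE !tokenE // subn0 !addn0.
exists y, (fire start_rule y); split.
- by rewrite rulesE rules_step_cat (idleP x).2 //= /enabled /= xa xr.
- by apply: reaches_step; rewrite /= /enabled /= y0.
- split=> [|l lL|r rM] /=; rewrite /fire /= count_nseq /= ?inE ?y0 ?tokenE //.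
  + by rewrite y_lab x_lab // (eq_sym 0); lia.
  + by rewrite y_reg x_reg // /input (eq_sym 0); case: eqP => _; lia.
- by rewrite /y /fire /= !count_nseq /= xa; split; lia.
Qed.

Lemma reduced_inc l t s :
  reduced ([:: lab l; fuel], [:: lab t, ash & map reg s]) = (t != l).
Proof.
rewrite /reduced /= !inE !tokenE //= !negb_or has_map andbT.
rewrite (@eq_has _ _ pred0) ?has_pred0 ?andbT // => r.
by rewrite /= !inE !tokenE.
Qed.

Lemma reduced_dec l t r :
  reduced ([:: lab l; fuel; reg r], [:: lab t; ash]) = (t != l).
Proof. by rewrite /reduced /= !inE !tokenE //= !negb_or; case: eqP. Qed.

Lemma instr_rules_off l x : x (lab l) = 0 -> rules_step (instr_rules l) x = None.
Proof.
move=> xl; apply/rules_step_None => rho; rewrite mem_filter => /andP[_].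
by case: (nth _ _ _) => [s t|r t t'] /[!inE]; [move=> /eqP->|case/orP => /eqP->];
  rewrite /enabled /= xl.
Qed.

Lemma rules_step_instr l x y : x start = 0 ->
  (forall k, k < L -> x (lab k) = (k == l)) -> l < L ->
  rules_step (instr_rules l) x = Some y -> rules_step rules x = Some y.
Proof.
move=> x0 x_lab lL xy; rewrite /= {1}/enabled /= x0 /=.
rewrite /rules_tail /front_tail -!catA rules_step_cat.
rewrite (@rules_step_flatten _ l) ?xy ?mem_iota // => k.
rewrite mem_iota => /andP[_ kL] kl.
by apply: instr_rules_off; rewrite x_lab // (negPf kl).
Qed.

Lemma simulate c c' x : represents c x -> machine_step P c = Some c' ->
  0 < x fuel -> exists y, [/\ rules_step rules x = Some y, represents c' y &
    [/\ y fuel = (x fuel).-1, y ash = (x ash).+1 & y reset = x reset]].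
Proof.
case: c => l z [x0 x_lab x_reg] + xf.
rewrite /fst /snd in x_lab x_reg; rewrite /machine_step.
have [lL|lL] := ltnP l L; last by rewrite nth_default // eqxx.
have x_l : x (lab l) = 1 by rewrite x_lab // eqxx.
have inc : forall s t, t != l -> exists y,
    [/\ fire ([:: lab l; fuel], [:: lab t, ash & map reg s]) x = y,
      represents (t, increment z s) y &
      [/\ y fuel = (x fuel).-1, y ash = (x ash).+1 & y reset = x reset]].
  move=> s t tl; eexists; split=> //.
    split=> [|k kL|r rM]; rewrite /fire /= !inE ?tokenE //=;
      rewrite ?count_reg ?count_nonreg ?x0 //=.
    - by move=> r; rewrite tokenE.
    - by rewrite x_lab // (eq_sym t) orbF !addn0 subnn add0n.
    - by move=> r; rewrite tokenE.
    - by rewrite x_reg // subn0.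
  have no_const i : i <= reset -> count_mem i (map reg s) = 0.
    by move=> ir; rewrite count_nonreg // => r; rewrite tokenE.
  by rewrite /fire /= !inE !tokenE //= !no_const //; split; lia.
have dec : forall r t, t != l -> r < M -> exists y,
    [/\ fire ([:: lab l; fuel; reg r], [:: lab t; ash]) x = y,
      represents (t, decrement z r) y &
      [/\ y fuel = (x fuel).-1, y ash = (x ash).+1 & y reset = x reset]].
  move=> r t tl rM; eexists; split=> //.
    split=> [|k kL|r' r'M]; rewrite /fire /= !inE ?tokenE //= ?x0 //=.
    - by rewrite x_lab // (eq_sym t) orbF !addn0 subnn add0n.
    - by rewrite x_reg //  !addn0 /decrement; case: eqP; lia.
  by rewrite /fire /= !inE !tokenE //=; split; lia.
have step := rules_step_instr x0 x_lab lL; rewrite /instr_rules in step.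
have Mr := @instr_registers_lt l; rewrite /registers in Mr.
case E: (nth _ _ _) => [s t|r t t'] in step Mr *.
  case: ifP => // /negbT tl [<-]; have [y [yE yP yc]] := inc s t tl.
  exists y; split=> //; apply: step.
  by rewrite /= reduced_inc tl /= /enabled /= x_l xf yE.
have rM : r < M by apply: Mr; exact: mem_head.
case: posnP => zr; last first.
  case: ifP => // /negbT tl [<-]; have [y [yE yP yc]] := dec r t tl rM.
  exists y; split=> //; apply: step.
  by rewrite /= reduced_dec tl /= /enabled /= x_l xf x_reg // zr yE.
(* The zero branch is treated as an increment by the empty list. *)
case: ifP => // /negbT tl [<-]; have [y [yE yP yc]] := inc [::] t' tl.
have zE : increment z [::] = z by apply: funext => i; exact: addn0.
exists y; split=> //; last by rewrite -zE.
apply: step; rewrite /= reduced_dec (reduced_inc _ _ [::]) tl.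
by case: ifP => _ /=; rewrite /enabled /= x_l xf ?x_reg // ?zr yE.
Qed.

Lemma simulate_iter n c c' x : represents c x ->
  iter n (obind (machine_step P)) (Some c) = Some c' -> n <= x fuel ->
  exists y, [/\ reaches (rules_step rules) x y, represents c' y &
    [/\ y fuel = x fuel - n, y ash = x ash + n & y reset = x reset]].
Proof.
elim: n c x => [|n IHn] c x cx /=.
  by move=> [<-] _; exists x; split; rewrite ?subn0 ?addn0 //; exact: reaches_refl.
rewrite -iterS iterSr /=; case E: (machine_step P c) => [c1|]; last by rewrite iter_None.
move=> c1c' nx; have [|y [xy c1y [yf ya yr]]] := simulate cx E; first by lia.
have [|z [yz c'z [zf za zr]]] := IHn _ _ c1y c1c'; first by lia.
exists z; split=> //; last by split; lia.
exact: reaches_trans (reaches_step xy) yz.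
Qed.

(** * Control tokens and idle states *)

Definition token_ix := [:: start, reset & map lab (iota 0 L)].

(** No rule of [front] increases this count, and it drops only when a jump leaves the program. *)
Definition tokens (x : store) := mass token_ix (fun _ => 1) x.

Lemma token_ix_uniq : uniq token_ix.
Proof.
have lab_inj : injective lab by move=> l l' /eqP; rewrite tokenE => /eqP.
rewrite /= !inE (map_inj_uniq lab_inj) iota_uniq andbT.
by apply/andP; split; apply/mapP => -[l _ /eqP]; rewrite tokenE.
Qed.

Lemma tokensE x : tokens x = x start + x reset + \sum_(l <- iota 0 L) x (lab l).
Proof.
rewrite /tokens /mass !big_cons big_map !mul1n addnA; congr (_ + _).
by apply: eq_bigr => l _; rewrite mul1n.
Qed.

Lemma tokens_idle x : idle x -> tokens x = x reset.
Proof.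
move=> [x0 _ xl]; rewrite tokensE x0 big1_seq ?addn0 // => l /andP[_].
by rewrite mem_iota => /andP[_ lL]; exact: xl.
Qed.

Lemma tokens_represents c x : represents c x -> tokens x = x reset + (c.1 < L).
Proof.
move=> [x0 xl _]; rewrite tokensE x0; congr (_ + _).
rewrite (@eq_big_seq _ _ _ _ _ _ (fun l => nat_of_bool (l == c.1))) => [|l]; last first.
  by rewrite mem_iota => /andP[_ lL]; exact: xl.
have [cL|cL] := ltnP c.1 L.
  rewrite (bigD1_seq c.1) ?mem_iota ?iota_uniq //= eqxx big1 // => l.
  by move/negPf->.
by rewrite big1_seq // => l /andP[_]; rewrite mem_iota; lia.
Qed.

Lemma mem_token_lab l : (lab l \in token_ix) = (l < L).
Proof.
rewrite !inE !tokenE //= mem_map ?mem_iota // => i j /eqP.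
by rewrite tokenE => /eqP.
Qed.

Lemma mem_token_reg r : (reg r \in token_ix) = false.
Proof.
by rewrite !inE !tokenE //=; apply/mapP => -[l _ /eqP]; rewrite tokenE.
Qed.

Lemma tokens_fire x rho : front_spec rho -> uniq rho.1 -> enabled rho x ->
  tokens (fire rho x) <= tokens x.
Proof.
move=> rhoP u1 ex; have := mass_fire (fun _ => 1) token_ix_uniq u1 ex.
rewrite -/(tokens _) -/(tokens _).
suff : \sum_(i <- rho.2 | i \in token_ix) 1 <= \sum_(i <- rho.1 | i \in token_ix) 1.
  by move=> le21 eq12; move: le21; rewrite -(leq_add2l (tokens x)) -eq12 leq_add2r.
have regs s : \sum_(i <- map reg s | i \in token_ix) 1 = 0.
  by rewrite big_map big1_seq // => r; rewrite mem_token_reg.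
have no_ash : ash \in token_ix = false.
  by rewrite !inE /=; apply/mapP => -[l _ /eqP]; rewrite tokenE.
case: rhoP => [|l s t lL _|l r t lL _|l t lL|r rM|l lL] /=.
  have -> : nseq e (reg 0) = map reg (nseq e 0) by rewrite map_nseq.
all: rewrite !(big_cons, big_nil) ?regs ?mem_token_lab ?mem_token_reg ?no_ash ?lL //=.
all: by do !case: ifP.
Qed.

Lemma front_uniq rho : front_spec rho -> uniq rho.1.
Proof. by case=> *; rewrite /= ?inE ?tokenE. Qed.

Lemma fuel_fire x rho : front_spec rho -> enabled rho x ->
  fire rho x fuel + fire rho x ash = x fuel + x ash.
Proof.
case=> [|l s t lL _|l r t lL _|l t lL|r rM|l lL];
  rewrite /enabled /fire /= ?inE ?tokenE //= => ex.
- by rewrite !count_nseq /=; lia.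
- have no_const i : i <= reset -> count_mem i (map reg s) = 0.
    by move=> ir; rewrite count_nonreg // => r; rewrite tokenE.
  by rewrite !no_const //; lia.
all: lia.
Qed.

(** The invariant is claimed at [y0], before ash becomes fuel, as [recover] may break it; the
    equations carry what is needed over to [y]. *)
Lemma drain (I : store -> Prop) x :
  (forall x rho, I x -> front_spec rho -> enabled rho x -> I (fire rho x)) ->
  I x -> exists y0 y, [/\ I y0, idle y0, reaches (rules_step rules) x y, idle y &
    [/\ y ash = 0, y fuel = y0 fuel + y0 ash & y reset = y0 reset]].
Proof.
move=> I_fire Ix; have [y0 [xy0 Iy0 /idleP idle_y0]] := normalize I_fire Ix.
have [y [y0y idle_y ya yf yr]] := recover idle_y0.
by exists y0, y; split=> //; exact: reaches_trans y0y.
Qed.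

(* A clean state with several [reset] tokens restarts the machine for one of them
   at a time, the others being inert; each restart has more fuel than the last,
   so eventually the machine reaches its end, which uses up this token. *)
Lemma rules_halt z : reaches (machine_step P) (0, input) (L, z) ->
  forall x, halts (rules_step rules) x.
Proof.
move=> [n run].
(* Lexicographic induction: [k] bounds the [reset] tokens and [d] the fuel still missing for a
   complete run of [n] steps. *)
have halts_idle k d x : idle x -> x ash = 0 -> x reset <= k -> n <= x fuel + d ->
    halts (rules_step rules) x.
  elim: k d x => [|k IHk] d x.
    move=> idle_x xa xr _; exists 1 => /=.
    rewrite -[LHS]/(rules_step rules x) rulesE rules_step_cat (idleP x).2 //=.
    by rewrite /enabled /= xa; case: (x reset) xr.
  elim/ltn_ind: d x => d IHd x idle_x xa; rewrite leq_eqVlt => /predU1P[xr|xr] nx;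
    last exact: IHk nx.
  have [|y [w [xy yw w_input [wa wf wr]]]] := restart idle_x xa; first by rewrite xr.
  have {}xy := reaches_trans (reaches_step xy) yw.
  have [n_le|n_gt] := leqP n (w fuel).
    have [u [wu u_end [_ _ ur]]] := simulate_iter w_input run n_le.
    (* The label [L] does not count as a token, so only [k] of the [k + 1] tokens remain. *)
    have [t v tk rhoP ex||v [t [vk idle_v ut idle_t [ta tf tr]]]] :=
        @drain (fun t => tokens t <= k) u.
    - exact: leq_trans (tokens_fire rhoP (front_uniq rhoP) ex) tk.
    - by rewrite (tokens_represents u_end) ltnn ur wr xr addn0.
    apply: reaches_halts (reaches_trans (reaches_trans xy wu) ut) (IHk n _ idle_t ta _ _).
      by rewrite tr -(tokens_idle idle_v).
    exact: leq_addl.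
  (* The run was too short: no token need be lost, but the extra unit of fuel lowers [d]. *)
  pose J u := tokens u <= k.+1 /\ u fuel + u ash = w fuel.
  have [u rho [uk uf] rhoP ex||v [u [[vt vf] idle_v wu idle_u [ua uf ur]]]] := @drain J w.
  - split; last by rewrite fuel_fire.
    exact: leq_trans (tokens_fire rhoP (front_uniq rhoP) ex) uk.
  - split; last by rewrite wa addn0.
    by rewrite (tokens_represents w_input) wr xr; case: (0 < L); lia.
  apply: reaches_halts (reaches_trans xy wu) (IHd d.-1 _ _ idle_u ua _ _).
  - by lia.
  - by rewrite ur -(tokens_idle idle_v).
  by rewrite uf vf; lia.
move=> x; have [_ [y [_ _ xy idle_y [ya _ _]]]] :=
  @drain (fun=> True) x (fun _ _ _ _ _ => I) I.
by apply: reaches_halts xy _; apply: (halts_idle (y reset) n) => //; exact: leq_addl.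
Qed.

(** A machine that never halts exhausts its fuel at a label inside the program; this label turns
    into [reset], and the next round starts. *)
Lemma rules_diverge x : ~ halts (machine_step P) (0, input) ->
  idle x -> x ash = 0 -> 0 < x reset -> ~ halts (rules_step rules) x.
Proof.
move=> loop idle_x xa xr.
apply: (@diverges _ _ (fun x => [/\ idle x, x ash = 0 & 0 < x reset])); last by split.
move=> {idle_x xa xr} {}x [idle_x xa xr].
have [y [z [xy yz z_input [za zf zr]]]] := restart idle_x xa xr.
case E: (iter (z fuel) (obind (machine_step P)) (Some (0, input))) => [c|];
  last by case: loop; exists (z fuel).
have [u [zu cu [uf _ ur]]] := simulate_iter z_input E (leqnn _).
have cL : c.1 < L.
  rewrite ltnNge; apply/negP => Lc; case: loop; exists (z fuel).+1.
  by rewrite iterS E; case: (c) Lc => l s Lc /=; rewrite nth_default // eqxx.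
(* Without [start] and fuel, registers are cleared and labels become [reset]; both preserve the
   number of control tokens. *)
pose J u := [/\ u start = 0, u fuel = 0 & 0 < tokens u].
have [||v [w [[_ _ tv] idle_v uw idle_w [wa _ wr]]]] := @drain J u.
- move=> v rho [v0 vf vt] rhoP ex.
  have u1 := front_uniq rhoP.
  have := mass_fire (fun _ => 1) token_ix_uniq u1 ex; rewrite -/(tokens _) -/(tokens _).
  case: rhoP ex {u1} => [|l s t lL _|l r t lL _|l t lL|r rM|l lL];
    rewrite /enabled /= ?v0 ?vf ?andbF // => _; rewrite !(big_cons, big_nil).
    by rewrite mem_token_reg !addn0 => tE; rewrite /J tE /fire /= v0 vf.
  rewrite mem_token_lab lL /= => /addIn tE.
  by rewrite /J tE /fire /= v0 vf.
- split; [by case: cu | by rewrite uf subnn|].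
  by rewrite (tokens_represents cu) cL addn1.
exists y, w; split=> //; first by apply: reaches_trans yz (reaches_trans zu uw).
by split=> //; rewrite wr -(tokens_idle idle_v).
Qed.

End Rules.

(** * Diagonalization *)

Fixpoint nth_prime i := if i is j.+1 then s2val (prime_above (nth_prime j)) else 2.

Lemma nth_primeP i : prime (nth_prime i).
Proof. by case: i => //= i; case: prime_above. Qed.

Lemma nth_prime_inj : injective nth_prime.
Proof.
have incr : {homo nth_prime : i j / i < j}.
  by apply: homo_ltn => [? ? ?|i /=]; [exact: ltn_trans | case: prime_above].
by move=> i j eij; case: (ltngtP i j) => // /incr; rewrite eij ltnn.
Qed.

Definition prime_product (s : seq nat) := \prod_(i <- s) nth_prime i.

Lemma prime_product_gt0 s : 0 < prime_product s.
Proof. by apply: prodn_gt0 => i; exact/prime_gt0/nth_primeP. Qed.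

Definition exponents (n : nat) : store := fun i => logn (nth_prime i) n.

Lemma exponents_product s i : exponents (prime_product s) i = count_mem i s.
Proof.
rewrite /exponents /prime_product; elim: s => [|j s IHs]; first by rewrite big_nil logn1.
rewrite big_cons lognM ?IHs; [|exact/prime_gt0/nth_primeP|exact: prime_product_gt0].
by rewrite logn_prime ?nth_primeP //= (inj_eq nth_prime_inj) eq_sym.
Qed.

Lemma dvdn_nth_prime i n : 0 < n -> (nth_prime i %| n) = (0 < exponents n i).
Proof. by move=> n0; rewrite -[nth_prime i]expn1 pfactor_dvdn ?nth_primeP. Qed.

Lemma coprime_nth_prime i s : coprime (nth_prime i) (prime_product s) = (i \notin s).
Proof.
rewrite prime_coprime ?nth_primeP // dvdn_nth_prime ?prime_product_gt0 //.
by rewrite exponents_product -has_count has_pred1.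
Qed.

Lemma dvdn_prime_product s n : 0 < n -> uniq s ->
  (prime_product s %| n) = all (fun i => 0 < exponents n i) s.
Proof.
move=> n0; elim: s => [|i s IHs] /=; first by rewrite /prime_product big_nil dvd1n.
case/andP=> i_s us; rewrite /prime_product big_cons Gauss_dvd ?coprime_nth_prime //.
by rewrite dvdn_nth_prime // IHs.
Qed.

Lemma coprime_prime_product s t : ~~ has (mem s) t ->
  coprime (prime_product t) (prime_product s).
Proof.
elim: t => [|i t IHt] /=; first by rewrite /prime_product big_nil coprime1n.
rewrite negb_or => /andP[i_s /IHt]; rewrite [prime_product (_ :: _)]big_cons coprimeMl.
by rewrite coprime_nth_prime i_s.
Qed.

Definition fraction (rho : rule) : rat :=
  ((prime_product rho.2)%:R / (prime_product rho.1)%:R)%R.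

Lemma fraction_gt0 rho : (0 < fraction rho)%R.
Proof. by rewrite divr_gt0 // ltr0n prime_product_gt0. Qed.

Lemma coprime_fraction rho : reduced rho ->
  coprime (prime_product rho.2) (prime_product rho.1).
Proof. by case/andP=> _; exact: coprime_prime_product. Qed.

Lemma numq_fraction rho : reduced rho -> `|numq (fraction rho)|%N = prime_product rho.2.
Proof.
move=> /coprime_fraction co; rewrite /fraction !pmulrn coprimeq_num //.
by rewrite gtr0_sg ?mul1r // ltz_nat prime_product_gt0.
Qed.

Lemma denq_fraction rho : reduced rho -> `|denq (fraction rho)|%N = prime_product rho.1.
Proof.
move=> /coprime_fraction co; rewrite /fraction !pmulrn coprimeq_den //.
by rewrite eqz_nat gtn_eqF ?prime_product_gt0.
Qed.

Lemma coprime_ratio_int a b n : 0 < b -> coprime a b ->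
  ((a%:R / b%:R * n%:R : rat)%R \is a Num.int) = (b %| n).
Proof.
move=> b0 co; have b0' : (b%:R : rat)%R != 0%R by rewrite pnatr_eq0 -lt0n.
apply/idP/idP => [/intrP[z ez]|/dvdnP[c ->]]; last first.
  by rewrite natrM mulrCA divfK // rpredM ?rpred_nat.
rewrite -(@Gauss_dvdr b a) 1?coprime_sym //.
have : (z * b%:Z = (a * n)%:Z)%R.
  apply: (@intr_inj rat); rewrite intrM -ez -!pmulrn natrM.
  by rewrite mulrAC divfK.
by move=> e; rewrite -[b]absz_nat -[_ * _]absz_nat -e abszM dvdn_mull.
Qed.

(** In lowest terms a fraction is applicable to [n] exactly when its denominator divides [n]; for a
    squarefree denominator this means that the rule is enabled. *)
Lemma fractran_step_rules rs n : (forall rho, rho \in rs -> reduced rho) -> 0 < n ->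
  if rules_step rs (exponents n) is Some y then
    0 < fractran_step (map fraction rs) n /\
    exponents (fractran_step (map fraction rs) n) = y
  else fractran_step (map fraction rs) n = 0.
Proof.
move=> + n0; elim: rs => //= rho rs IHrs red.
have red_rho := red _ (mem_head _ _); have /andP[u1 _] := red_rho.
rewrite coprime_ratio_int ?prime_product_gt0 ?coprime_fraction //.
rewrite dvdn_prime_product // -/(enabled rho (exponents n)); case: ifP => en; last first.
  by apply: IHrs => rho' rs'; apply: red; rewrite inE rs' orbT.
have dn : prime_product rho.1 %| n by rewrite dvdn_prime_product.
have -> : (fraction rho * n%:R)%R
    = (prime_product rho.2 * (n %/ prime_product rho.1))%:R%R :> rat.
  rewrite -{1}(divnK dn) !natrM /fraction [((_ %/ _)%:R * _)%R]mulrC mulrA divfK //.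
  by rewrite pnatr_eq0 -lt0n prime_product_gt0.
rewrite natrK; have q0 : 0 < n %/ prime_product rho.1.
  by rewrite divn_gt0 ?prime_product_gt0 // dvdn_leq.
split; first by rewrite muln_gt0 prime_product_gt0.
apply: funext => i; rewrite /fire /exponents lognM ?prime_product_gt0 // logn_div //.
by rewrite -!/(exponents _ _) !exponents_product (count_uniq_mem _ u1) addnC.
Qed.

Lemma fractran_halts_rules rs n : (forall rho, rho \in rs -> reduced rho) -> 0 < n ->
  (exists k, iter k (fractran_step (map fraction rs)) n = 0) <->
  halts (rules_step rs) (exponents n).
Proof.
move=> red n0; split=> -[k]; elim: k n n0 => [|k IHk] n n0.
- by move=> /= n_eq; rewrite n_eq in n0.
- have := fractran_step_rules red n0; rewrite iterSr.
  case E: (rules_step _ _) => [y|] => [[m0 ey] /(IHk _ m0)[j hj]|_ _].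
    by exists j.+1; rewrite iterSr /= E -ey.
  by exists 1; rewrite /= E.
- by [].
- rewrite iterSr; have := fractran_step_rules red n0; rewrite /=.
  case: (rules_step _ _) => [y|] => [[m0 <-] /(IHk _ m0)[j hj]|m0 _].
    by exists j.+1; rewrite iterSr.
  by exists 1.
Qed.

(** * Computing the code of the program from the machine input *)

Definition scale a r t := Then (Loop r (Add (nseq a t))) (Loop t (Add [:: r])).

Lemma runs_scale a r t x : r != t -> x t = 0 ->
  runs (scale a r t) x (fun y => y r = a * x r /\ forall i, i != r -> y i = x i).
Proof.
move=> rt xt.
apply: (runs_Then (runs_move x _)) => [|y yE]; first by rewrite mem_nseq negb_and rt orbT.
apply: runs_weaken (runs_move y _) _ => [|z zE]; first by rewrite inE eq_sym.
have yt : y t = x r * a by rewrite yE eq_sym (negPf rt) count_nseq /= eqxx mul1n xt.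
split=> [|i ir]; rewrite zE.
  by rewrite (negPf rt) yE !eqxx yt /= eqxx; lia.
case: eqP => [->|/eqP it]; first by rewrite xt.
by rewrite yE (negPf ir) count_nseq /= (eq_sym r) (negPf ir) (eq_sym t) (negPf it); lia.
Qed.

Definition scale_power a c r t := Loop c (scale a r t).

Lemma runs_scale_power a c r t x : uniq [:: c; r; t] -> x t = 0 ->
  runs (scale_power a c r t) x (fun y => y r = a ^ x c * x r /\
    forall i, i != c -> i != r -> y i = x i).
Proof.
rewrite /= !inE negb_or !andbT => /andP[/andP[cr ct] rt] xt.
pose I n (y : store) := [/\ y c = n, a ^ n * y r = a ^ x c * x r &
  forall i, i != c -> i != r -> y i = x i].
apply: (@runs_weaken _ _ (fun y => y c = 0 /\ exists n, I n y)).
  apply: (@runs_Loop _ _ _ (x c)) => // n y [yc yr yE] y_gt0.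
  apply: runs_weaken (runs_scale _ rt _) _ => [|z [zr zE]].
    by rewrite /decrement eq_sym (negPf ct) yE // eq_sym.
  exists n.-1; first by rewrite -yc prednK.
  split=> [||i ic ir].
  - by rewrite zE // /decrement eqxx yc.
  - by rewrite zr /decrement eq_sym (negPf cr) mulnA -expnSr prednK -?yc // yc.
  - by rewrite zE // /decrement (negPf ic) yE.
by move=> y [yc [n [yn yr yE]]]; split=> //; rewrite -yr -yn yc mul1n.
Qed.

(** The exponent of 2 is the numerator of [start_rule], which heads the encoded list; the odd part
    is meant to be [e] itself. *)
Definition self_code e := 2 ^ (nth_prime (lab 0) * nth_prime (reg 0) ^ e) * e.

(** Register 3 becomes the exponent of 2 in [self_code e], with the copy of [e] in register 1 as
    counter; then register 0, which still holds [e], is doubled that many times. *)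
Definition prepare :=
  Then (copy 0 1 2)
 (Then (Add (nseq (nth_prime (lab 0)) 3))
 (Then (scale_power (nth_prime (reg 0)) 1 3 4)
       (scale_power 2 3 0 4))).

Lemma runs_prepare e :
  runs prepare (input e) (fun y => y 0 = self_code e).
Proof.
apply: (runs_Then (runs_copy (input e) _)) => // x [x1 xE].
have x1E : x 1 = e by rewrite x1 /input eqxx.
eapply runs_Then; first by eexists; [exact: exec_Add | exact: erefl].
move=> y <-{y}; set y := increment x _.
have yE i : i != 3 -> y i = x i.
  by move=> i3; rewrite /y /increment count_nseq /= eq_sym (negPf i3) addn0.
have y3 : y 3 = nth_prime (lab 0) by rewrite /y /increment count_nseq /= xE // mul1n.
apply: (runs_Then (@runs_scale_power _ 1 3 4 y _ _)) => // [|z [z3 zE]].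
  by rewrite yE ?xE.
apply: runs_weaken (@runs_scale_power _ 3 0 4 z _ _) _ => // [|u [u0 _]].
  by rewrite zE ?yE ?xE.
by rewrite u0 z3 y3 zE // yE // x1E yE // xE // [_ ^ e * _]mulnC.
Qed.

Section Diagonal.
Variable d : murec 1.

Definition diagonal_body := Then prepare (compile d [:: 0] 1 2).

(** The final loop exits at once if [d] answers 0 and runs forever if [d] answers 1. *)
Definition diagonal := program (Then diagonal_body (Loop 1 (Add [:: 1]))).

Lemma runs_diagonal_body e y : murec_eval d [tuple self_code e] y ->
  runs diagonal_body (input e) (fun z => z 1 = y).
Proof.
move=> dy; apply: (runs_Then (runs_prepare e)) => x x0.
have args : tval [tuple self_code e] = map x [:: 0] by rewrite /= x0.
by apply: runs_weaken (compile_correct dy args _ _ _) _ => // z [].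
Qed.

(* The machine input [e] occurs only in the first numerator of the Fractran
   program, hence only in the power of 2 in the code of the program. Choosing the
   odd part of this code for [e] makes the code equal to [self_code e]. *)
Definition diagonal_input :=
  (CodeSeq.code (prime_product [:: start]
    :: flatten [seq [:: prime_product rho.2; prime_product rho.1]
                   | rho <- rules_tail diagonal])).*2.+1.

Definition diagonal_rules := rules diagonal diagonal_input.

Lemma diagonal_fractions_neq0 : map fraction diagonal_rules != [::].
Proof. by []. Qed.

Lemma diagonal_fractions_gt0 : all (fun q => 0 < q)%R (map fraction diagonal_rules).
Proof. by rewrite all_map; apply/allP => rho _; exact: fraction_gt0. Qed.

Definition diagonal_fractran := Fractran diagonal_fractions_neq0 diagonal_fractions_gt0.

Lemma encode_diagonal : encode_fractran diagonal_fractran = self_code diagonal_input.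
Proof.
have fractionsE : [seq [:: `|numq q|; `|denq q|] | q <- diagonal_fractran]
    = [seq [:: prime_product rho.2; prime_product rho.1] | rho <- diagonal_rules].
  rewrite -map_comp; apply/eq_in_map => rho /reduced_rules red /=.
  by rewrite numq_fraction // denq_fraction.
rewrite /encode_fractran fractionsE /diagonal_rules /rules map_cons.
(* By definition [CodeSeq.code] splits off the first numerator as an exponent of 2; the rest of the
   list, free of [e], gives the odd factor [diagonal_input]. *)
rewrite -[LHS]/(2 ^ prime_product (lab 0 :: nseq _ _) * diagonal_input).
rewrite /self_code; congr (2 ^ _ * _).
by rewrite /prime_product big_cons big_nseq iter_muln_1.
Qed.

Lemma diagonal_halting :
  (murec_eval d [tuple encode_fractran diagonal_fractran] 0 ->
    forall n, exists k, iter k (fractran_step diagonal_fractran) n = 0) /\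
  (murec_eval d [tuple encode_fractran diagonal_fractran] 1 ->
    ~ forall n, exists k, iter k (fractran_step diagonal_fractran) n = 0).
Proof.
rewrite encode_diagonal; split=> d_eval; have [y xy y1] := runs_diagonal_body d_eval.
  move=> n; have [->|n0] := posnP n; first by exists 0.
  apply/(fractran_halts_rules (@reduced_rules _ _) n0).
  apply: (@rules_halt _ _ y); apply: program_halts.
  by apply: exec_Then xy _; exact: exec_Loop_stop.
(* The diverging input is the state with a single [reset] token. *)
have p0 : 0 < prime_product [:: reset] by exact: prime_product_gt0.
move=> /(_ (prime_product [:: reset])) halt.
have {halt} := (fractran_halts_rules (@reduced_rules diagonal diagonal_input) p0).1 halt.
have eE i : exponents (prime_product [:: reset]) i = (reset == i).
  by rewrite exponents_product /= addn0.
apply: rules_diverge; rewrite ?eE //.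
  by apply: program_diverges xy _; rewrite y1.
by split=> [|r _|l _]; rewrite eE ?tokenE.
Qed.

End Diagonal.

Theorem corollary2 :
  undecidable encode_fractran
    (fun F : fractran => additive_system (fractran_collection F)).
Proof.
move=> [d d_dec]; have [complete incomplete] := d_dec (diagonal_fractran d).
have [halt0 halt1] := diagonal_halting d.
(* Completeness would make [d] answer 1 and the program diverge somewhere. Hence [d] answers 0, the
   program halts everywhere, and the collection is complete after all. *)
have not_complete : ~ additive_system (fractran_collection (diagonal_fractran d)).
  move=> A; apply: (halt1 (complete A)); exact/fractran_complete_halting.
apply/not_complete/fractran_complete_halting; exact/halt0/incomplete.
Qed.
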